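(* Let $\Bbbk$ be a field of characteristic $0$ and let $t,m,n$ be integers with $1<t<m\le n$ and $n>t+1$. For $i\in\{1,\ldots,\lfloor t/2\rfloor\}$ let $(\gamma^i|\lambda^i)$ be the pair of partitions of $3t$ defined as follows. If $t$ is even: $$\gamma^i=\Big(\tfrac{3t}{2}-i+1,\ \tfrac{3t}{2}-i+1,\ 2(i-1)\Big),\qquad \lambda^i=\Big(2(t-i+1),\ \tfrac t2+i-1,\ \tfrac t2+i-1\Big).$$ If $t$ is odd: $$\gamma^i=\Big(\tfrac{3t-1}{2}-i+1,\ \tfrac{3t-1}{2}-i+1,\ 2(i-1)+1\Big),\qquad \lambda^i=\Big(2(t-i+1)-1,\ \tfrac{t+1}2+i-1,\ \tfrac{t+1}2+i-1\Big).$$ Then $(\gamma^i|\lambda^i)$ is a minimal irreducible representation of $J_t(m,n)$ of degree $3$ in the following cases: 1. if $t$ is even, when $\frac t2\ge i\ge\max\{0,\ \frac{3t}2-m+1,\ t-\frac n2+1\}$; 2. if $t$ is odd, when $\frac{t-1}2\ge i\ge\max\{0,\ \frac{3t-1}2-m+1,\ t-\frac{n-1}2\}$.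
   Context: Let $X=(x_{ij})$ be an $m\times n$ matrix of indeterminates over $\Bbbk$, $R=\Bbbk[x_{ij}]$, $A_t(m,n)\subseteq R$ the $\Bbbk$-subalgebra generated by the $t$-minors of $X$, $S_t(m,n)$ the polynomial ring over $\Bbbk$ whose variables are indexed by the $t$-minors of $X$ (standard graded), $\pi:S_t(m,n)\to A_t(m,n)$ the surjection sending each variable to the corresponding minor, and $J_t(m,n)=\ker\pi$. Let $W,V$ be $\Bbbk$-vector spaces of dimension $m,n$ and $G=\operatorname{GL}(W)\times\operatorname{GL}(V)$. Identify $S_t(m,n)$ with $\operatorname{Sym}(\bigwedge^tW\otimes\bigwedge^tV^* )$ and $R$ with $\operatorname{Sym}(W\otimes V^* )$ (using bases of $W$, $V$); then $G$ acts, $\pi$ is $G$-equivariant and $J_t(m,n)$ is a $G$-subrepresentation. For a partition $\lambda=(\lambda_1\ge\dots\ge\lambda_k)$ (trailing zeros dropped), $L_\lambda V$ denotes the Schur module with the convention $L_{(p)}V\cong\bigwedge^pV$, $L_{(1^p)}V\cong\operatorname{Sym}^pV$; it is the irreducible polynomial $\operatorname{GL}(V)$-representation whose highest weight is the transpose partition of $\lambda$. $L_\lambda V^*$ denotes its dual. ''$(\gamma|\lambda)$ is a minimal irreducible representation of $J_t(m,n)$ of degree $3$'' means that the irreducible $G$-representation $L_\gamma W\otimes L_\lambda V^*$ occurs in the degree $3$ component of $J_t(m,n)$ and that its (nonzero) elements are minimal generators of the ideal $J_t(m,n)$. *)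

(* Defs.v *)
From HB Require Import structures.
From mathcomp Require Export all_boot all_order all_fingroup all_algebra.
From mathcomp Require Export mpoly.

Set Implicit Arguments.
Unset Strict Implicit.
Unset Printing Implicit Defensive.

Import GRing.Theory.
Local Open Scope ring_scope.

(* Throughout W = k^m and V = k^n with their standard bases (e_i) and (f_j),
   and G = GL(W) x GL(V) is the set of pairs (a, b) of invertible matrices;
   a matrix g acts by g e_j = \sum_i g i j *: e_i. *)

(* A t-minor is indexed by its increasing sequences of rows and columns. *)
Definition incr (t m : nat) :=
  {f : {ffun 'I_t -> 'I_m} |
    [forall a : 'I_t, forall b : 'I_t, (a < b)%N ==> (f a < f b)%N]}.

Definition minor_idx (t m n : nat) := (incr t m * incr t n)%type.

Definition minor (A : comNzRingType) (t m n : nat) (M : 'M[A]_(m, n))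
    (I : incr t m) (J : incr t n) : A :=
  \det (mxsub (val I) (val J) M).

Section MinorIdeal.
Variables (k : fieldType) (t m n : nat).

Definition polyR := {mpoly k[(m * n)%N]}.

Definition generic_mx : 'M[polyR]_(m, n) :=
  \matrix_(i, j) 'X_(mxvec_index i j).

Definition polyS := {mpoly k[#|{: minor_idx t m n}|]}.

Definition minor_var (I : incr t m) (J : incr t n) : polyS :=
  'X_(enum_rank (I, J)).

Definition minor_map (f : polyS) : polyR :=
  f \mPo [tuple minor generic_mx (enum_val u).1 (enum_val u).2
         | u < #|{: minor_idx t m n}|].

Definition in_J (f : polyS) : Prop := minor_map f = 0.

(* The product m J, where m is the ideal generated by the variables, i.e. the
   polynomials with zero constant coefficient. *)
Definition in_mJ (f : polyS) : Prop :=
  exists s : seq (polyS * polyS),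
    (forall u, u \in s -> u.1@_0%MM = 0 /\ in_J u.2) /\
    f = \sum_(u <- s) u.1 * u.2.

(* For homogeneous f, this says that f belongs to a minimal system of
   homogeneous generators of J. *)
Definition minimal_generator (f : polyS) : Prop := in_J f /\ ~ in_mJ f.

(* The variable of index (I, J) stands for the tensor of e_I in /\^t W and of
   f_J^* in /\^t V^*; on the dual basis, b f_j^* = \sum_q b^-1 j q *: f_q^*. *)
Definition actS (a : 'M[k]_m) (b : 'M[k]_n) (f : polyS) : polyS :=
  f \mPo [tuple \sum_(P : incr t m) \sum_(Q : incr t n)
            (minor a P (enum_val u).1 * minor (invmx b) (enum_val u).2 Q)
              *: minor_var P Q
         | u < #|{: minor_idx t m n}|].

End MinorIdeal.

(* The boxes of the Young diagram of la: Tagged _ c is the box in row i and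
   column c, for c < la_i. Zero parts contribute no box. *)
Definition box (la : seq nat) := {i : 'I_(size la) & 'I_(nth 0%N la i)}.

Definition row_of la (x : box la) : nat := tag x.
Definition col_of la (x : box la) : nat := tagged x.

Section Schur.
Variables (k : fieldType) (la : seq nat) (n : nat).

(* The tensor power of k^n with one factor per box of la: T f is the
   coefficient of the tensor of the basis vectors e_(f x), x : box la. *)
Definition tens := {ffun {ffun box la -> 'I_n} -> k^o}.

Definition tens_act_fun (g : 'M[k]_n) (T : tens) : tens :=
  [ffun f : {ffun box la -> 'I_n} =>
    \sum_(h : {ffun box la -> 'I_n}) (\prod_x g (f x) (h x)) * T h].

Definition place (s : {perm box la}) (f : {ffun box la -> 'I_n}) :=
  [ffun x => f (s x)].

Definition row_alt_fun (T : tens) : tens :=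
  [ffun f => \sum_(s : {perm box la} | [forall x, row_of (s x) == row_of x])
               (-1) ^+ s * T (place s f)].

Definition col_sym_fun (T : tens) : tens :=
  [ffun f => \sum_(s : {perm box la} | [forall x, col_of (s x) == col_of x])
               T (place s f)].

Fact tens_act_linear g : linear (tens_act_fun g).
Proof.
move=> c T U; apply/ffunP=> f; rewrite !ffunE scaler_sumr -big_split /=.
by apply: eq_bigr => h _; rewrite !ffunE mulrDr; congr (_ + _); apply: mulrCA.
Qed.

Fact row_alt_linear : linear row_alt_fun.
Proof.
move=> c T U; apply/ffunP=> f; rewrite !ffunE scaler_sumr -big_split /=.
by apply: eq_bigr => h _; rewrite !ffunE mulrDr; congr (_ + _); apply: mulrCA.
Qed.

Fact col_sym_linear : linear col_sym_fun.
Proof.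
move=> c T U; apply/ffunP=> f; rewrite !ffunE scaler_sumr -big_split /=.
by apply: eq_bigr => h _; rewrite !ffunE.
Qed.

HB.instance Definition _ g :=
  GRing.isLinear.Build k tens tens _ (tens_act_fun g) (tens_act_linear g).
HB.instance Definition _ :=
  GRing.isLinear.Build k tens tens _ row_alt_fun row_alt_linear.
HB.instance Definition _ :=
  GRing.isLinear.Build k tens tens _ col_sym_fun col_sym_linear.

Definition tens_act (g : 'M[k]_n) : 'End(tens) := linfun (tens_act_fun g).
Definition row_alt : 'End(tens) := linfun row_alt_fun.
Definition col_sym : 'End(tens) := linfun col_sym_fun.

(* The Schur module L_la(k^n), i.e. the image of the composite
     /\^(la_1) (x) ... (x) /\^(la_r) -> tensors -> Sym^(la'_1) (x) Sym^(la'_2) ...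
   where, the characteristic being 0, the exterior powers along the rows and
   the symmetric powers along the columns are seen as the antisymmetric, resp.
   symmetric, tensors. Thus L_(p) is the p-th exterior power and L_(1^p) the
   p-th symmetric power, and the highest weight is the transpose of la. *)
Definition schur : {vspace tens} := limg (col_sym \o row_alt)%VF.

Definition schur_act (g : 'M[k]_n) : 'End(subvs_of schur) :=
  (linfun (vsproj schur) \o tens_act g \o linfun vsval)%VF.

Lemma tens_act_row_alt g T :
  tens_act g (row_alt T) = row_alt (tens_act g T).
Proof.
rewrite !lfunE; apply/ffunP=> f; rewrite !ffunE /=.
under eq_bigr do rewrite ffunE mulr_sumr.
rewrite exchange_big /=; apply: eq_bigr => s _; rewrite ffunE mulr_sumr.
have inj : injective (place s).
  move=> h h' /ffunP e; apply/ffunP=> x.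
  by have := e ((s^-1)%g x); rewrite !ffunE permKV.
rewrite [RHS](reindex_inj inj) /=; apply: eq_bigr => h _.
rewrite mulrCA; congr (_ * (_ * _)).
by rewrite (reindex_inj (@perm_inj _ s)) /=; apply: eq_bigr => x _; rewrite !ffunE.
Qed.

Lemma tens_act_col_sym g T :
  tens_act g (col_sym T) = col_sym (tens_act g T).
Proof.
rewrite !lfunE; apply/ffunP=> f; rewrite !ffunE /=.
under eq_bigr do rewrite ffunE mulr_sumr.
rewrite exchange_big /=; apply: eq_bigr => s _; rewrite ffunE.
have inj : injective (place s).
  move=> h h' /ffunP e; apply/ffunP=> x.
  by have := e ((s^-1)%g x); rewrite !ffunE permKV.
rewrite [RHS](reindex_inj inj) /=; apply: eq_bigr => h _; congr (_ * _).
by rewrite (reindex_inj (@perm_inj _ s)) /=; apply: eq_bigr => x _; rewrite !ffunE.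
Qed.

Lemma schur_stable g T : T \in schur -> tens_act g T \in schur.
Proof.
case/memv_imgP=> U _ ->; apply/memv_imgP; exists (tens_act g U).
  exact: memvf.
by rewrite !comp_lfunE tens_act_col_sym tens_act_row_alt.
Qed.

Lemma vsval_schur_act g (u : subvs_of schur) :
  vsval (schur_act g u) = tens_act g (vsval u).
Proof.
have -> : schur_act g u = vsproj schur (tens_act g (vsval u)).
  by rewrite !comp_lfunE [linfun vsval _]lfunE [LHS]lfunE.
by rewrite vsprojK // schur_stable ?subvsP.
Qed.

End Schur.

(* The G-representation L_ga W (x) (L_la V)^*, as Hom(L_la V, L_ga W). *)
Definition schur_hom (k : fieldType) (m n : nat) (ga la : seq nat) :=
  'Hom(subvs_of (schur k la n), subvs_of (schur k ga m)).

Definition schur_hom_act (k : fieldType) (m n : nat) (ga la : seq nat)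
    (a : 'M[k]_m) (b : 'M[k]_n) (h : schur_hom k m n ga la) :
    schur_hom k m n ga la :=
  (schur_act ga a \o h \o schur_act la (invmx b))%VF.

(* An equivariant embedding phi of L_ga W (x) (L_la V)^* in the degree d part
   of J whose nonzero values are minimal generators. The first conjunct
   excludes the zero module (L_ga W = 0 when ga_1 > m). *)
Definition minimal_irreducible (k : fieldType) (t m n d : nat)
    (ga la : seq nat) : Prop :=
  (exists h : schur_hom k m n ga la, h != 0) /\
  exists phi : {linear schur_hom k m n ga la -> polyS k t m n},
  [/\ injective phi,
      forall (a : 'M[k]_m) (b : 'M[k]_n) (h : schur_hom k m n ga la),
        a \in unitmx -> b \in unitmx ->
        phi (schur_hom_act a b h) = actS a b (phi h),
      forall h, phi h \is d.-homog /\ in_J (phi h) &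
      forall h, h != 0 -> minimal_generator (phi h)].

(* For 1 <= i <= t %/ 2 none of the subtractions below truncates and all the
   divisions are exact. *)
Definition gamma (t i : nat) : seq nat :=
  if odd t then
    [:: (3 * t - 1) %/ 2 - i + 1; (3 * t - 1) %/ 2 - i + 1; 2 * (i - 1) + 1]%N
  else
    [:: (3 * t) %/ 2 - i + 1; (3 * t) %/ 2 - i + 1; 2 * (i - 1)]%N.

Definition lambda (t i : nat) : seq nat :=
  if odd t then
    [:: 2 * (t - i + 1) - 1; (t + 1) %/ 2 + i - 1; (t + 1) %/ 2 + i - 1]%N
  else
    [:: 2 * (t - i + 1); t %/ 2 + i - 1; t %/ 2 + i - 1]%N.

(* Main.v *)
(* Put u = t/2 - i + 1 (integer division), so that gamma = (t+u, t+u, t-2u) and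
   lambda = (t+2u, t-u, t-u). Writing c for the Young symmetrizer (column
   symmetrizer C after row antisymmetrizer R) of gamma or lambda, and B for the
   antisymmetrizer of three blocks of t tensor positions, a homomorphism
   h : L_lambda V -> L_gamma W induces an element of the tensor product of
   (/\^t W)^(x)3 and (/\^t V^* )^(x)3, hence a cubic form in the variables
   indexed by the t-minors.

   This cubic is a relation because lambda_1 > gamma_1: two positions of the
   first row of lambda always lie in the same column of gamma, and exchanging
   them changes the sign.

   It is not in S_1 J_2 because both shapes have a unique two-rowed predecessor,
   and these agree: (t+u, t-u). Concretely, up to sign, B s c is either 0 or B c
   for every permutation s of the positions of two blocks, with the same sign for
   gamma and lambda, so pairing a product of two variables with B c on both sides
   is, up to a nonzero factor, averaging over these permutations, i.e. taking
   its image among the polynomials in the x_ij. As the pairing is also invariant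
   under the cyclic permutation of the blocks, it kills S_1 J_2. Finally it
   recovers h, since c C B c is a nonzero multiple of c: it is a multiple of c by
   von Neumann's lemma, and nonzero by positivity over the rationals. *)

From HB Require Import structures.
Require Import Defs.
From mathcomp Require Import all_boot all_order all_algebra.
From mathcomp Require Import zify ring lra.

Set Implicit Arguments.
Unset Strict Implicit.
Unset Printing Implicit Defensive.

Import Order.TTheory GRing.Theory Num.Theory.
Local Open Scope ring_scope.

(** Complete reducibility and Pieri's rule are replaced by explicit identities between symmetrizers
    of tensors, whose positions carry row, column and block labels. The obstacle is that positivity
    holds over the rationals, whereas the scalar is needed in [k]: each scalar is therefore an
    integer chosen before the field and the tensor, and characteristic 0 keeps it nonzero.
    Positivity rests on the choice of tableaux: block numbers increase strictly down the columns, so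
    that nothing cancels in a well-chosen coefficient. The equality of signs for the two shapes is
    seen as follows. Some positions of two blocks are paired by sharing a column, in the same way in
    both tableaux. If a permutation puts the two members of a pair into one block, the result is 0.
    Otherwise, up to exchanges inside pairs and permutations preserving blocks, it only permutes the
    unpaired positions. For lambda these are alone in their columns; for gamma their column mates in
    the third block follow them without leaving that block. Both shapes thus yield the sign of the
    permutation of the unpaired positions. *)

Definition ten (k : fieldType) (B : finType) (n : nat) :=
  {ffun {ffun B -> 'I_n} -> k^o}.

(** * Permutations of tensor positions *)

Section Relabel.
Variables (B : finType).

(** Induction on the size of [D]: a transposition brings the right value to one point, which is then
    removed. *)
Lemma relabel (T : eqType) (D : {set B}) (f g : B -> T) :
  (forall c, #|[set x in D | f x == c]| = #|[set x in D | g x == c]|) ->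
  exists2 s : {perm B}, perm_on D s & {in D, forall x, f (s x) = g x}.
Proof.
elim: {D}#|D| {-2}D (erefl #|D|) f => [|N IH] D cD f eq_fg.
  exists 1%g; first exact: perm_on1.
  by move=> x xD; move/eqP: cD; rewrite cards_eq0 => /eqP D0; rewrite D0 inE in xD.
have [x xD] : exists x, x \in D by apply/card_gt0P; rewrite cD.
have : (0 < #|[set y in D | f y == g x]|)%N.
  by rewrite eq_fg; apply/card_gt0P; exists x; rewrite inE xD /=.
case/card_gt0P=> y; rewrite inE => /andP[yD /eqP fy].
pose f' z := f (tperm x y z).
have cD' : #|D :\ x| = N by move: cD; rewrite (cardsD1 x) xD => -[].
have [|s s_on fs] := IH _ cD' f'.
  move=> c; have := eq_fg c.
  rewrite (cardsD1 y) (cardsD1 x [set z in D | g z == c]) !in_set xD yD fy.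
  move/addnI => eqc.
  transitivity #|[set z in D | g z == c] :\ x|; last first.
    by apply: eq_card => z; rewrite !inE andbA.
  rewrite -eqc -[RHS](card_preimset _ (@perm_inj _ (tperm x y))).
  apply: eq_card => z; rewrite !inE /f'.
  case: tpermP => [->|->|nx ny]; first by rewrite !eqxx.
    by rewrite [y == x]eq_sym xD yD andbA.
  by rewrite (introF eqP nx) (introF eqP ny) andbA.
exists (s * tperm x y)%g.
  apply/subsetP=> z; rewrite inE permM => nz; apply: contraR nz => zD.
  have sz : s z = z by apply: out_perm s_on _; rewrite !inE negb_and zD orbT.
  by rewrite sz tpermD //; [move: zD; apply: contraNneq => <- | move: zD; apply: contraNneq => <-].
move=> z zD; rewrite permM; case: (z =P x) => [->|/eqP nzx].
  by rewrite (out_perm s_on) ?tpermL ?fy // !inE eqxx.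
by rewrite -[LHS]/(f' (s z)) fs // !inE nzx.
Qed.

End Relabel.

(** * Young subgroups *)

Section Young.
Variable B : finType.

Definition young (l : B -> nat) : {set {perm B}} :=
  [set s : {perm B} | [forall x, l (s x) == l x]].

Lemma youngP l (s : {perm B}) : reflect (forall x, l (s x) = l x) (s \in young l).
Proof. by rewrite inE; apply: (iffP forallP) => h x; apply/eqP/h. Qed.

Lemma young1 l : 1%g \in young l.
Proof. by apply/youngP=> x; rewrite perm1. Qed.

Lemma youngM l s s' : s \in young l -> s' \in young l -> (s * s')%g \in young l.
Proof. by move=> /youngP h /youngP h'; apply/youngP=> x; rewrite permM h' h. Qed.

Lemma youngV l s : (s^-1%g \in young l) = (s \in young l).
Proof.
have h u : u \in young l -> u^-1%g \in young l.
  by move=> /youngP hu; apply/youngP=> x; rewrite -[in RHS](permKV u x) hu.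
by apply/idP/idP => /h; rewrite ?invgK.
Qed.

Lemma young_mulr l s s' : s \in young l -> ((s' * s)%g \in young l) = (s' \in young l).
Proof.
move=> hs; apply/idP/idP => h; last exact: youngM.
by rewrite -[s'](mulgK s) youngM ?youngV.
Qed.

Lemma young_mull l s s' : s \in young l -> ((s * s')%g \in young l) = (s' \in young l).
Proof.
move=> hs; apply/idP/idP => h; last exact: youngM.
by rewrite -[s'](mulKg s) youngM ?youngV.
Qed.

Lemma young_tperm l x y : l x = l y -> tperm x y \in young l.
Proof. by move=> e; apply/youngP=> z; case: tpermP => [->|->|]. Qed.

End Young.

(** The sign can be read off a factorization into transpositions. This serves for permutations
    carried to one block or along a bijection. *)
Lemma odd_perm_morph (A B : finType) (phi : {perm A} -> {perm B}) (i : A -> B) :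
  injective i -> (forall s s', phi (s * s')%g = (phi s * phi s')%g) ->
  (forall x y, phi (tperm x y) = tperm (i x) (i y)) ->
  forall s, odd_perm (phi s) = odd_perm s.
Proof.
move=> i_inj phiM phi_tperm s; have [ts -> ] := prod_tpermP s.
elim: ts => [|[x y] ts IH] /=.
  have phi1 : phi 1%g = 1%g by apply: (mulIg (phi 1%g)); rewrite mul1g -phiM mulg1.
  by rewrite big_nil phi1 !odd_perm1.
case/andP=> /= nxy /IH; rewrite big_cons phiM !odd_permM => ->; congr (_ (+) _).
by rewrite phi_tperm !odd_tperm (inj_eq i_inj).
Qed.

(** * Symmetrizers and antisymmetrizers of tensors *)

Section Place.
Variables (k : fieldType) (B : finType) (n : nat).
Local Notation T := (ten k B n).
Implicit Types (t u : ten k B n) (s : {perm B}) (l : B -> nat) (e : bool).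

Definition comp_perm s (f : {ffun B -> 'I_n}) := [ffun x => f (s x)].

Lemma comp_permM s s' f : comp_perm s (comp_perm s' f) = comp_perm (s * s')%g f.
Proof. by apply/ffunP=> x; rewrite !ffunE permM. Qed.

Lemma comp_perm1 f : comp_perm 1%g f = f.
Proof. by apply/ffunP=> x; rewrite !ffunE perm1. Qed.

Lemma comp_permK s : cancel (comp_perm s) (comp_perm s^-1%g).
Proof. by move=> f; rewrite comp_permM mulVg comp_perm1. Qed.

Lemma comp_permKV s : cancel (comp_perm s^-1%g) (comp_perm s).
Proof. by move=> f; rewrite comp_permM mulgV comp_perm1. Qed.

Lemma comp_perm_inj s : injective (comp_perm s).
Proof. exact: can_inj (comp_permK s). Qed.

Definition pl s t : T := [ffun f => t (comp_perm s f)].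

Fact pl_linear s : linear (pl s).
Proof. by move=> c t u; apply/ffunP=> f; rewrite !ffunE. Qed.
HB.instance Definition _ s := GRing.isLinear.Build k T T _ (pl s) (pl_linear s).

Lemma plM s s' t : pl s (pl s' t) = pl (s' * s)%g t.
Proof. by apply/ffunP=> f; rewrite !ffunE comp_permM. Qed.

Lemma pl1 t : pl 1%g t = t.
Proof. by apply/ffunP=> f; rewrite !ffunE comp_perm1. Qed.

(* [young_op true l] antisymmetrizes and [young_op false l] symmetrizes along
   the fibres of [l]. *)
Definition young_op e l t : T := \sum_(s in young l) (-1) ^+ (e && s) *: pl s t.

Fact young_op_linear e l : linear (young_op e l).
Proof.
move=> c t u; rewrite /young_op scaler_sumr -big_split /=; apply: eq_bigr => s _.
by rewrite linearP scalerDr !scalerA mulrC.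
Qed.
HB.instance Definition _ e l :=
  GRing.isLinear.Build k T T _ (young_op e l) (young_op_linear e l).

Lemma sign_permM e s s' :
  (-1) ^+ (e && (s * s')%g) = (-1) ^+ (e && s) * (-1) ^+ (e && s') :> k.
Proof. by case: e; rewrite ?mulr1 //= odd_permM signr_addb. Qed.

Lemma young_op_eq e l l' t :
  (forall x y, (l x == l y) = (l' x == l' y)) -> young_op e l t = young_op e l' t.
Proof.
move=> h; apply: eq_bigl => s; rewrite !inE; apply: eq_forallb => x; exact: h.
Qed.

Lemma pl_young_op e l s t : s \in young l ->
  pl s (young_op e l t) = (-1) ^+ (e && s) *: young_op e l t.
Proof.
move=> hs; rewrite /young_op linear_sum scaler_sumr /=.
rewrite [RHS](reindex_inj (mulIg s)) /=; apply: eq_big => s'.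
  by rewrite young_mulr.
move=> _; rewrite linearZ /= plM scalerA sign_permM mulrCA.
by rewrite -signr_addb addbb mulr1.
Qed.

Lemma young_op_pl e l s t : s \in young l ->
  young_op e l (pl s t) = (-1) ^+ (e && s) *: young_op e l t.
Proof.
move=> hs; rewrite /young_op scaler_sumr.
rewrite [RHS](reindex_inj (mulgI s)) /=; apply: eq_big => s'.
  by rewrite young_mull.
move=> _; rewrite plM scalerA sign_permM mulrA.
by rewrite -signr_addb addbb mul1r.
Qed.

Lemma pl_young_opC e l s t : (forall x y, (l (s x) == l (s y)) = (l x == l y)) ->
  pl s (young_op e l t) = young_op e l (pl s t).
Proof.
move=> hs; rewrite /young_op linear_sum /=.
rewrite [RHS](reindex_inj (conjg_inj s)) /=; apply: eq_big => s'.
  rewrite !inE; apply/forallP/forallP => h x.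
    by rewrite -[x](permKV s) permJ hs h.
  by rewrite -hs -permJ h.
move=> _; rewrite linearZ /= !plM odd_permJ; congr (_ *: pl _ _).
by rewrite conjgE !mulgA mulgV mul1g.
Qed.

Lemma young_op_young_op e l t :
  young_op e l (young_op e l t) = #|young l|%:R *: young_op e l t.
Proof.
rewrite {1}/young_op (eq_bigr (fun=> young_op e l t)); last first.
  by move=> s hs; rewrite pl_young_op // scalerA -signr_addb addbb scale1r.
by rewrite sumr_const scaler_nat.
Qed.

(** Exchanging [x] and [y] fixes the symmetrized tensor, but after transport by [s] it changes the
    sign under antisymmetrization. *)
Lemma alt_sym_eq0 l l' s t x y :
  2%:R != 0 :> k -> x != y -> l' x = l' y -> l (s x) = l (s y) ->
  young_op true l (pl s (young_op false l' t)) = 0.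
Proof.
move=> k2 nxy e' e; set U := young_op false l' t.
have h : young_op true l (pl s U) = - young_op true l (pl s U).
  rewrite -{1}[U](_ : pl (tperm x y) U = U); last first.
    by rewrite pl_young_op ?young_tperm // scale1r.
  rewrite plM (_ : (tperm x y * s)%g = (s * tperm (s x) (s y))%g); last first.
    by rewrite -tpermJ conjgE !mulgA mulgV mul1g.
  rewrite -plM young_op_pl ?young_tperm // odd_tperm (inj_eq perm_inj) nxy /=.
  by rewrite expr1 scaleN1r.
have : 2%:R *: young_op true l (pl s U) = 0.
  by rewrite scaler_nat mulr2n {1}h addNr.
by move/eqP; rewrite scaler_eq0 (negPf k2) => /eqP.
Qed.

Lemma sym_alt_eq0 l l' s t x y :
  2%:R != 0 :> k -> x != y -> l' x = l' y -> l (s x) = l (s y) ->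
  young_op false l (pl s (young_op true l' t)) = 0.
Proof.
move=> k2 nxy e' e; set U := young_op true l' t.
have h : young_op false l (pl s U) = - young_op false l (pl s U).
  rewrite -[U in RHS]opprK -[- U](_ : pl (tperm x y) U = - U); last first.
    by rewrite pl_young_op ?young_tperm // odd_tperm nxy expr1 scaleN1r.
  rewrite !linearN opprK /= plM.
  rewrite (_ : (tperm x y * s)%g = (s * tperm (s x) (s y))%g); last first.
    by rewrite -tpermJ conjgE !mulgA mulgV mul1g.
  by rewrite -plM [RHS]young_op_pl ?young_tperm // scale1r.
have : 2%:R *: young_op false l (pl s U) = 0.
  by rewrite scaler_nat mulr2n {1}h addNr.
by move/eqP; rewrite scaler_eq0 (negPf k2) => /eqP.
Qed.

(** The symmetrizers are self-adjoint for this form, which over the rationals is positive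
    definite. *)
Definition dot t u : k := \sum_f t f * u f.

Lemma dotC t u : dot t u = dot u t.
Proof. by apply: eq_bigr => f _; rewrite mulrC. Qed.

Lemma dotZl c t u : dot (c *: t) u = c * dot t u.
Proof. by rewrite mulr_sumr; apply: eq_bigr => f _; rewrite ffunE mulrA. Qed.

Lemma dot_suml I r (P : pred I) F u :
  dot (\sum_(i <- r | P i) F i) u = \sum_(i <- r | P i) dot (F i) u.
Proof.
rewrite /dot exchange_big; apply: eq_bigr => f _ /=.
by rewrite sum_ffunE mulr_suml.
Qed.

Lemma dot_pl s t u : dot (pl s t) u = dot t (pl s^-1%g u).
Proof.
rewrite /dot (reindex_inj (@comp_perm_inj s^-1%g)); apply: eq_bigr => f _ /=.
by rewrite !ffunE comp_permKV.
Qed.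

Lemma dot_young_op e l t u : dot (young_op e l t) u = dot t (young_op e l u).
Proof.
rewrite dot_suml [RHS]dotC dot_suml (reindex_inj invg_inj) /=.
apply: eq_big => s; first by rewrite youngV.
by move=> _; rewrite !dotZl dot_pl invgK [dot (pl _ _) _]dotC odd_permV.
Qed.

Definition delta (f : {ffun B -> 'I_n}) : T := [ffun g => (g == f)%:R].

Lemma dot_delta t f : dot t (delta f) = t f.
Proof.
rewrite /dot (bigD1 f) //= ffunE eqxx mulr1 big1 ?addr0 // => g /negPf nfg.
by rewrite ffunE nfg mulr0.
Qed.

Lemma ten_delta t : t = \sum_f t f *: delta f.
Proof.
apply/ffunP=> f; rewrite sum_ffunE (bigD1 f) //= !ffunE eqxx.
rewrite [_ *: _]mulr1 big1 ?addr0 // => g /negPf nfg.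
by rewrite !ffunE eq_sym nfg [_ *: _]mulr0.
Qed.

Lemma pl_delta s f : pl s (delta f) = delta (comp_perm s^-1%g f).
Proof.
apply/ffunP=> g; rewrite !ffunE; congr (_%:R); congr nat_of_bool.
by apply/eqP/eqP => [<-|->]; rewrite ?comp_permK ?comp_permKV.
Qed.

End Place.

(** * Young symmetrizers *)

Section Shape.
Variables (B : finType) (row col : B -> nat) (ht : nat -> nat).

(** A diagram is given by its column heights, and its boxes are named by abstract positions, so that
    two diagrams and the blocks can share one set of positions. *)
Definition young_shape :=
  [/\ forall x y, row x = row y -> col x = col y -> x = y,
      forall x, (row x < ht (col x))%N &
      forall r c, (r < ht c)%N -> exists x, row x = r /\ col x = c].

Hypothesis shapeP : young_shape.

Lemma boxP r c : (r < ht c)%N -> {x | row x = r & col x = c}.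
Proof.
move=> h; have [_ _ /(_ r c h) ex] := shapeP.
pose P := [pred x | (row x == r) && (col x == c)].
have exP : exists x, P x by case: ex => x [/eqP r_ /eqP c_]; exists x; apply/andP.
by exists (xchoose exP); have /andP[/eqP h1 /eqP h2] := xchooseP exP.
Qed.

(* For every [j], a column of height [h] holds at most [min h j] labels below
   [j]; these bounds add up to the number of labels below [j], so each is
   attained. *)
Lemma label_lt_ht (s : {perm B}) (L : B -> nat) :
  (forall x, L (s x) = row x) ->
  (forall x y, col x = col y -> L x = L y -> x = y) ->
  forall x, (L x < ht (col x))%N.
Proof.
have [inj lt_ht _] := shapeP; move=> Ls Linj x0; rewrite ltnNge; apply/negP=> x0P.
set c0 := col x0 in x0P; pose j := ht c0.
pose A := [set x | (L x < j)%N]; pose A' := [set x | (row x < j)%N].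
have cA : #|A| = #|A'|.
  rewrite -(card_preimset A (@perm_inj _ s)); apply: eq_card => x.
  by rewrite !inE Ls.
(* In a column with at least [j] boxes, [psi] moves a position to the row named by its label; in a
   shorter column it does nothing. It injects [A] into [A'] within columns, hence is onto by
   cardinality. *)
pose psi x := match (L x < ht (col x))%N =P true with
  | ReflectT h => if (j <= ht (col x))%N then s2val (boxP h) else x
  | ReflectF _ => x end.
have psi_col x : col (psi x) = col x.
  by rewrite /psi; case: eqP => // h; case: ifP => // _; case: (boxP h).
have psi_row x : x \in A -> (j <= ht (col x))%N -> row (psi x) = L x.
  rewrite inE => xA jx; rewrite /psi; case: eqP => [h|[]]; last first.
    exact: leq_trans xA jx.
  by rewrite jx; case: (boxP h).
have psi_id x : (j <= ht (col x))%N = false -> psi x = x.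
  by move=> jx; rewrite /psi; case: eqP => // h; rewrite jx.
have psiA : psi @: A \subset A'.
  apply/subsetP=> _ /imsetP[x xA ->]; rewrite inE.
  case: (boolP (j <= ht (col x))%N) => [jx|].
    by rewrite psi_row //; rewrite inE in xA.
  move/negPf => jx; rewrite psi_id //; move/negbT: jx; rewrite -ltnNge => hj.
  exact: leq_trans (lt_ht x) (ltnW hj).
have psi_inj : {in A &, injective psi}.
  move=> x y xA yA e; have ec : col x = col y by rewrite -psi_col e psi_col.
  case: (boolP (j <= ht (col x))%N) => [jx|/negPf jx].
    by apply: Linj => //; rewrite -psi_row // e psi_row // -ec.
  by move: e; rewrite !psi_id // -ec.
have psiE : psi @: A = A'.
  by apply/eqP; rewrite eqEcard psiA card_in_imset // cA leqnn.
(* Column [c0] lies entirely in [A'], so it has no more boxes than [A] has in that column; but [x0]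
   is there and outside [A]. *)
have : [set x | col x == c0] \subset psi @: [set x in A | col x == c0].
  apply/subsetP=> w; rewrite inE => /eqP wc.
  have : w \in A' by rewrite inE /j -wc lt_ht.
  rewrite -psiE => /imsetP[x xA ew]; apply/imsetP; exists x => //.
  by rewrite inE xA -wc ew psi_col eqxx.
move/subset_leq_card; rewrite leqNgt => /negP; apply.
apply: leq_ltn_trans (leq_imset_card _ _) _; apply: proper_card.
apply/properP; split; first by apply/subsetP=> x; rewrite inE => /andP[_ xc]; rewrite inE.
by exists x0; rewrite !inE ?eqxx // andbT -leqNgt.
Qed.

(** Von Neumann's lemma: either two positions of one row are sent to one column and the composite
    vanishes, or [s] is a row permutation followed by a column permutation. The integer is 0, 1 or
    -1. *)
Lemma csym_pl_ralt (s : {perm B}) : exists z : int,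
  forall (k : fieldType) n (t : ten k B n), 2%:R != 0 :> k ->
    young_op false col (pl s (young_op true row t)) =
      z%:~R *: young_op false col (young_op true row t).
Proof.
have [inj lt_ht _] := shapeP.
case: (boolP [exists x, exists y, [&& x != y, row x == row y & col (s x) == col (s y)]]).
  case/existsP=> x /existsP[y /and3P[nxy /eqP exy /eqP esxy]].
  exists 0 => k n t k2; rewrite scale0r.
  exact: sym_alt_eq0 nxy exy esxy.
(* [L x] is the row from which [s] brings a position to [x]. In a column these labels are distinct
   and, by [label_lt_ht], below its height, so a column permutation can sort them. *)
move=> Nex; pose L x := row ((s^-1)%g x).
have Linj x y : col x = col y -> L x = L y -> x = y.
  move=> ec eL; apply/eqP/negPn/negP => nxy; case/negP: Nex.
  apply/existsP; exists ((s^-1)%g x); apply/existsP; exists ((s^-1)%g y).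
  by rewrite (inj_eq perm_inj) nxy !permKV ec -/(L x) -/(L y) eL !eqxx.
have Lht := @label_lt_ht s L (fun x => congr1 row (permK s x)) Linj.
pose p x := s2val (boxP (Lht x)).
have prow x : row (p x) = L x by rewrite /p; case: (boxP (Lht x)).
have pcol x : col (p x) = col x by rewrite /p; case: (boxP (Lht x)).
have p_inj : injective p.
  by move=> x y e; apply: Linj; [rewrite -pcol e pcol | rewrite -prow e prow].
have pY : (perm p_inj)^-1%g \in young col.
  by rewrite youngV; apply/youngP=> x; rewrite permE.
have qY : (s * perm p_inj)%g \in young row.
  by apply/youngP=> x; rewrite permM permE prow /L permK.
exists ((-1) ^+ (s * perm p_inj)%g) => k n t _.
rewrite -{1}[s](mulgK (perm p_inj)) -plM young_op_pl // scale1r pl_young_op //.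
by rewrite linearZ /= rmorph_sign.
Qed.

(** The integer depends on [s] but neither on the field nor on the tensor: it can be studied over
    the rationals and used in [k]. Quantifying over all [s] makes the property stable under further
    symmetrizers. *)
Definition absorbed (X : forall (k : fieldType) n, ten k B n -> ten k B n) :=
  forall s : {perm B}, exists z : int, forall (k : fieldType) n (t : ten k B n),
    2%:R != 0 :> k ->
    young_op false col (pl s (X k n t)) =
      z%:~R *: young_op false col (young_op true row t).

Lemma absorbed_young_op e l X :
  absorbed X -> absorbed (fun k n t => young_op e l (X k n t)).
Proof.
move=> hX s; have /fin_all_exists [z zP] s' := hX (s' * s)%g.
exists (\sum_(s' in young l) (-1) ^+ (e && s') * z s') => k n t k2.
have := fun s' => zP s' k n t k2; move: (young_op false col (young_op true _ _)) => v zv.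
rewrite [young_op e l _]/young_op !linear_sum rmorph_sum /= scaler_suml /=.
apply: eq_bigr => s' _; rewrite !linearZ /= plM zv scalerA.
by rewrite rmorphM /= rmorph_sign.
Qed.

Variable blk : B -> nat.
Hypothesis semistd : forall x y, col x = col y -> (row x < row y)%N -> (blk x < blk y)%N.

(** Row by row from the top: once the earlier rows are fixed, [p] can only move a box of row [r]
    downwards, which raises its block, whereas [q] preserves the sum of the blocks over the row.
    Equality of the sums fixes every box. *)
Lemma semistd_rigid (p q : {perm B}) : p \in young col -> q \in young row ->
  (forall x, blk (p x) = blk (q x)) -> p = 1%g.
Proof.
have [inj _ _] := shapeP; move=> /youngP pY /youngP qY e.
suff fix_row r x : row x = r -> p x = x.
  by apply/perm.permP=> x; rewrite perm1 (fix_row (row x)).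
elim/ltn_ind: r x => r IH.
have le_row x : row x = r -> (row x <= row (p x))%N.
  move=> xr; rewrite leqNgt; apply/negP=> lt; have := IH _ _ (p x) erefl.
  by rewrite -xr => /(_ lt) /perm_inj pxx; rewrite pxx ltnn in lt.
have le_blk x : row x == r -> (blk x <= blk (p x) ?= iff (p x == x))%N.
  move/eqP=> xr; apply/leqifP; case: eqP => [->//|npx].
  apply: semistd; rewrite ?pY // ltn_neqAle le_row // andbT.
  by apply/eqP=> er; case: npx; apply: inj; rewrite ?pY.
have [_] := leqif_sum le_blk.
rewrite (_ : \sum_(i | row i == r) blk (p i) = \sum_(i | row i == r) blk i)%N; last first.
  rewrite [RHS](reindex_inj (@perm_inj _ q)) /=; apply: eq_big => x; first by rewrite qY.
  by rewrite e.
by rewrite eqxx => /esym/forall_inP h x /eqP/h/eqP.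
Qed.

(** For a basis tensor with distinct factors, the coefficient at itself is a signed sum over the
    triples [b], [p], [q] of product 1. Rigidity forces [p = 1] and [b = q^-1], so every surviving
    term is 1. *)
Lemma ralt_csym_blk_neq0 : exists t : ten rat B #|B|,
  young_op true row (young_op false col (young_op true blk t)) != 0.
Proof.
pose id_ := [ffun x : B => enum_rank x].
have fixed (s : {perm B}) : (comp_perm s id_ == id_) = (s == 1%g).
  apply/eqP/eqP => [/ffunP h|->]; last by rewrite comp_perm1.
  by apply/perm.permP=> x; have := h x; rewrite !ffunE perm1 => /enum_rank_inj.
exists (delta rat id_); apply/eqP=> /ffunP /(_ id_) /eqP; rewrite [X in _ == X]ffunE; apply/negP.
have -> : young_op true row
   (young_op false col (young_op true blk (delta rat id_))) id_ =
   \sum_(q in young row) \sum_(p in young col) \sum_(b in young blk)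
     (-1) ^+ q * (-1) ^+ b * ((b * (p * q))%g == 1%g)%:R.
  rewrite /young_op sum_ffunE; apply: eq_bigr => q _.
  rewrite ffunE ffunE sum_ffunE scaler_sumr; apply: eq_bigr => p _.
  rewrite ffunE ffunE scale1r sum_ffunE scaler_sumr; apply: eq_bigr => b _.
  by rewrite !ffunE !comp_permM fixed -!mulrA mulgA.
rewrite lt0r_neq0 //; apply: (@lt_le_trans _ _ 1) => //.
have term q p b : q \in young row -> p \in young col -> b \in young blk ->
    (-1) ^+ q * (-1) ^+ b * ((b * (p * q))%g == 1%g)%:R = ((b * (p * q))%g == 1%g)%:R :> rat.
  move=> qY pY bY; case: eqP => [e|_]; last by rewrite !mulr0.
  have p1 : p^-1%g = 1%g.
    apply: (@semistd_rigid _ q); rewrite ?youngV // => w.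
    have := congr1 (fun v : {perm B} => v ((b^-1)%g ((p^-1)%g w))) e.
    rewrite !permM !permKV perm1 => ->.
    by apply/esym/youngP; rewrite youngV.
  have p_1 : p = 1%g by rewrite -[p]invgK p1 invg1.
  have bq : b = q^-1%g by move: e; rewrite p_1 mul1g => e; rewrite -[b](mulgK q) e mul1g.
  by rewrite bq odd_permV mulr1 -signr_addb addbb.
rewrite (bigD1 1%g) ?young1 //= (bigD1 1%g) ?young1 //= (bigD1 1%g) ?young1 //=.
rewrite odd_perm1 !mulg1 eqxx !mulr1 -!addrA lerDl !addr_ge0 //.
- by apply: sumr_ge0 => b /andP[bY _]; have := term _ _ b (young1 _) (young1 _) bY; rewrite odd_perm1 !mulg1 => ->.
- apply: sumr_ge0 => p /andP[pY _]; apply: sumr_ge0 => b bY.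
  by have := term _ _ _ (young1 _) pY bY; rewrite odd_perm1 !mulg1 => ->.
apply: sumr_ge0 => q /andP[qY _]; apply: sumr_ge0 => p pY.
by apply: sumr_ge0 => b bY; rewrite term.
Qed.

Lemma dot_eq0 n (t : ten rat B n) : dot t t = 0 -> t = 0.
Proof.
move/eqP; rewrite psumr_eq0 => [/allP h|f _]; last exact: sqr_ge0.
apply/ffunP=> f; rewrite [RHS]ffunE; apply/eqP.
by have := h f (mem_index_enum f); rewrite -expr2 sqrf_eq0.
Qed.

(** Up to the order of the Young subgroup, [young_op] is an orthogonal projection, so its quadratic
    form vanishes only on vectors that it kills. *)
Lemma young_op_eq0 e l n (t u : ten rat B n) :
  dot (young_op e l t) u = 0 -> u = t -> young_op e l t = 0.
Proof.
move=> h ut; apply: dot_eq0; rewrite dot_young_op young_op_young_op.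
by rewrite dotC dotZl -{2}ut h mulr0.
Qed.

(* If the scalar vanished then, over the rationals, positivity of [dot] would
   make [R C B] vanish, for [C], [R], [B] the (anti)symmetrizers along [col],
   [row], [blk]. *)
Lemma symmetrizer_scalar : exists2 z : int, z != 0 &
  forall (k : fieldType) n (t : ten k B n), 2%:R != 0 :> k ->
    young_op false col (young_op true row (young_op false col
      (young_op true blk (young_op false col (young_op true row t))))) =
    z%:~R *: young_op false col (young_op true row t).
Proof.
have h0 : absorbed (fun k n t => young_op true row t) by exact: csym_pl_ralt.
have h := absorbed_young_op true row (absorbed_young_op false col
  (absorbed_young_op true blk (absorbed_young_op false col h0))).
have [z zP] := h 1%g; exists z => [|k n t k2]; last by rewrite -zP // pl1.
apply/eqP=> z0; have [t /eqP[]] := ralt_csym_blk_neq0.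
have {}zP u : young_op false col (young_op true row (young_op false col
    (young_op true blk (young_op false col (young_op true row u))))) = 0 :> ten rat B #|B|.
  by have := zP _ _ u isT; rewrite z0 scale0r pl1.
(* The form of [B] at [C R C u] is the pairing of [u] with the vanishing operator [C R C B C R]
   applied to [C u]. *)
have step1 u : young_op true blk (young_op false col (young_op true row
    (young_op false col u))) = 0 :> ten rat B #|B|.
  apply: young_op_eq0 erefl.
  rewrite -dot_young_op -dot_young_op -dot_young_op zP.
  by rewrite -(scale0r (0 : ten rat B #|B|)) dotZl mul0r.
apply: young_op_eq0 erefl; set v := young_op false col _.
have := step1 (young_op true blk t).
rewrite /v -!dot_young_op => ->.
by rewrite -(scale0r (0 : ten rat B #|B|)) dotZl mul0r.
Qed.

End Shape.

(** * Permutations of whole columns *)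

Section ColumnPerm.
Variables (B : finType) (row col : B -> nat) (ht : nat -> nat).

Lemma pl_row_perm (k : fieldType) n (q : {perm B}) (t : ten k B n) :
  q \in young row -> (forall x y, (col (q x) == col (q y)) = (col x == col y)) ->
  pl q (young_op false col (young_op true row t)) =
    (-1) ^+ q *: young_op false col (young_op true row t).
Proof. by move=> qY qC; rewrite pl_young_opC // pl_young_op // linearZ. Qed.

Hypothesis shapeP : young_shape row col ht.

(** [s] is a permutation that moves the columns along the rows, which acts by its sign, followed by
    one inside the columns, which acts trivially. *)
Lemma pl_column_perm (s : {perm B}) :
  (forall x y, (col (s x) == col (s y)) = (col x == col y)) ->
  (forall x, ht (col (s x)) = ht (col x)) ->
  exists e : bool, forall (k : fieldType) n (t : ten k B n),
  pl s (young_op false col (young_op true row t)) =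
    (-1) ^+ e *: young_op false col (young_op true row t).
Proof.
move=> sC sH; have [inj lt_ht _] := shapeP.
have lt x : (row x < ht (col (s x)))%N by rewrite sH.
pose q x := s2val (boxP shapeP (lt x)).
have qrow x : row (q x) = row x by rewrite /q; case: (boxP _ _).
have qcol x : col (q x) = col (s x) by rewrite /q; case: (boxP _ _).
have q_inj : injective q.
  move=> x y e; apply: inj; first by rewrite -qrow e qrow.
  by apply/eqP; rewrite -sC -!qcol e.
have qY : perm q_inj \in young row by apply/youngP=> x; rewrite permE.
have pY : ((perm q_inj)^-1 * s)%g \in young col.
  apply/youngP=> x; rewrite permM -qcol -[q _](permE q_inj) permKV //.
exists (perm q_inj : bool) => k n t.
rewrite -[s](mulKVg (perm q_inj)) -plM pl_row_perm //; last first.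
  by move=> x y; rewrite !permE !qcol sC.
by rewrite linearZ /= pl_young_op // scale1r.
Qed.

End ColumnPerm.

(** * The two tableaux *)

Ltac iflia :=
  repeat match goal with |- context [if ?b then _ else _] =>
    lazymatch b with context [if _ then _ else _] => fail | _ => idtac end;
    case: (boolP b) => //= ? end; lia.

Section Tableaux.
Local Open Scope nat_scope.
Variables (t u : nat).
Local Notation U := ('I_3 * 'I_t)%type.

Definition blk (x : U) : nat := x.1.

(* A position [(c, j)] is the [j]-th slot of block [c], that is of the [c]-th
   factor of a cubic monomial. The first tableau places the positions on the
   diagram [(t + u, t + u, t - 2 * u)]: each of its [t - 2 * u] columns of
   height 3 meets all blocks, and each pair of blocks fills [u] columns of
   height 2. *)

Definition grow (x : U) : nat :=
  if x.1 == 0 :> nat then 0 else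
  if x.1 == 1 :> nat then (if x.2 < t - u then 1 else 0) else
  if x.2 < t - 2 * u then 2 else 1.

Definition gcol (x : U) : nat :=
  if x.1 == 0 :> nat then x.2 : nat else
  if x.1 == 1 :> nat then (if x.2 < t - u then x.2 : nat else x.2 + u) else
  if x.2 < t - 2 * u then x.2 : nat else x.2 + u.

Definition ght (c : nat) : nat :=
  if c < t - 2 * u then 3 else if c < t + u then 2 else 0.

(* The second tableau, on [(t + 2 * u, t - u, t - u)], has [t - u] columns of
   height 3 meeting all blocks and [u] singleton columns for each block. *)
Definition lrow (x : U) : nat := if x.2 < t - u then x.1 : nat else 0.
Definition lcol (x : U) : nat := if x.2 < t - u then x.2 : nat else x.2 + x.1 * u.
Definition lht (c : nat) : nat :=
  if c < t - u then 3 else if c < t + 2 * u then 1 else 0.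

Lemma pos_eq (x y : U) : x.1 = y.1 :> nat -> x.2 = y.2 :> nat -> x = y.
Proof. by case: x y => [a b] [c d] /= /val_inj -> /val_inj ->. Qed.

Lemma pos_ex b j : (b < 3)%N -> (j < t)%N -> exists x : U, x.1 = b :> nat /\ x.2 = j :> nat.
Proof. by move=> hb hj; exists (Ordinal hb, Ordinal hj). Qed.

(** Coordinates out of range default to those of [x], so that positions can be moved by plain
    arithmetic. *)
Definition mkpos (x : U) (b j : nat) : U := (insubd x.1 b, insubd x.2 j).

Lemma mkpos1 x b j : b < 3 -> (mkpos x b j).1 = b :> nat.
Proof. by move=> h; rewrite /= val_insubd h. Qed.

Lemma mkpos2 x b j : j < t -> (mkpos x b j).2 = j :> nat.
Proof. by move=> h; rewrite /= val_insubd h. Qed.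

Lemma pos1_lt (x : U) : x.1 < 3. Proof. exact: ltn_ord. Qed.
Lemma pos2_lt (x : U) : x.2 < t. Proof. exact: ltn_ord. Qed.

(* These are the positions of blocks 0 and 1 that share a column, in both
   tableaux. *)
Definition paired (x : U) := (x.1 < 2) && (x.2 < t - u).
Definition flip (x : U) : U := if paired x then mkpos x (1 - x.1) x.2 else x.

Definition single_pos (x : U) := (x.1 < 2) && (t - u <= x.2).
Definition mate_pos (x : U) := (x.1 == 2 :> nat) && (t - 2 * u <= x.2).

(* The bijection between the singles of blocks 0 and 1 and the positions of
   block 2 lying in the same column of the first tableau. *)
Definition mir (x : U) : U :=
  if single_pos x then mkpos x 2 (if x.1 == 0 :> nat then x.2 - u else x.2) else
  if mate_pos x then (if x.2 < t - u then mkpos x 0 (x.2 + u) else mkpos x 1 x.2) else x.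

Definition next (b : nat) := if b == 2 then 0 else b.+1.
(** Exchanges the last two intervals of length [u] of a block. In the first tableau each of them
    shares its columns of height 2 with one other block. Rotating blocks 0 and 1 requires this
    exchange for columns to go to columns, rotating block 2 does not. *)
Definition half (j : nat) :=
  if j < t - 2 * u then j else if j < t - u then j + u else j - u.
Definition brot (x : U) : U := mkpos x (next x.1) x.2.
(* [brot] composed with a permutation preserving the blocks, so as to map the
   columns of the first tableau to columns. *)
Definition brot' (x : U) : U :=
  mkpos x (next x.1) (if x.1 < 2 then half x.2 else x.2).

Lemma brot1 x : (brot x).1 = next x.1 :> nat.
Proof. by apply: mkpos1; have := pos1_lt x; rewrite /next; iflia. Qed.
Lemma brot2 x : (brot x).2 = x.2 :> nat.
Proof. exact: mkpos2 (pos2_lt x). Qed.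

Lemma flip1 x : (flip x).1 = (if paired x then 1 - x.1 else x.1) :> nat.
Proof. by rewrite /flip; case: ifP => // h; rewrite mkpos1 //; lia. Qed.
Lemma flip2 x : (flip x).2 = x.2 :> nat.
Proof. by rewrite /flip; case: ifP => // h; rewrite mkpos2 // pos2_lt. Qed.

Lemma mir1 x : (mir x).1 = (if single_pos x then 2 else
  if mate_pos x then (if x.2 < t - u then 0 else 1) else x.1) :> nat.
Proof.
rewrite /mir; case: ifP => [_|_]; first by rewrite mkpos1.
by case: ifP => // _; case: ifP => // _; rewrite mkpos1.
Qed.

Lemma flipK : involutive flip.
Proof.
move=> x; apply: pos_eq; rewrite !(flip1, flip2) /paired ?(flip1, flip2) /paired;
  move: (pos1_lt x) (pos2_lt x); move: (nat_of_ord x.1) (nat_of_ord x.2) => b j; iflia.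
Qed.

Lemma brot_inj : injective brot.
Proof.
move=> x y e; have := congr1 (fun z : U => z.1 : nat) e; have := congr1 (fun z : U => z.2 : nat) e.
rewrite !brot1 !brot2 /next => e2 e1; apply: pos_eq => //.
by move: e1 (pos1_lt x) (pos1_lt y); iflia.
Qed.

Lemma gcol_flip x : gcol (flip x) = gcol x.
Proof.
rewrite /gcol !flip1 !flip2 /paired.
by move: (nat_of_ord x.1) (nat_of_ord x.2) => b j; iflia.
Qed.

Lemma lcol_flip x : lcol (flip x) = lcol x.
Proof.
rewrite /lcol !flip1 !flip2 /paired.
move: (pos1_lt x); move: (nat_of_ord x.1) (nat_of_ord x.2) => b j.
case: b => [|[|[|//]]] _ /=; iflia.
Qed.

Hypotheses (u_gt0 : (0 < u)%N) (le_2u_t : (2 * u <= t)%N).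

Lemma gshape : young_shape grow gcol ght.
Proof.
split.
- move=> [[b hb] [j hj]] [[b' hb'] [j' hj']]; rewrite /grow /gcol /= => h1 h2.
  apply: pos_eq => /=; move: h1 h2; iflia.
- by move=> [[b hb] [j hj]]; rewrite /grow /gcol /ght /=; iflia.
move=> r c; rewrite /ght => h.
pose b := if r == 0 then (if c < t then 0 else 1) else
  if r == 1 then (if c < t - u then 1 else 2) else 2.
pose j := if c < t - 2 * u then c else if r == 0 then (if c < t then c else c - u)
  else if c < t - u then c else c - u.
have [||x [xb xj]] := @pos_ex b j.
- by rewrite /b; iflia.
- by move: h; rewrite /j; iflia.
exists x; rewrite /grow /gcol xb xj /b /j; move: h; iflia.
Qed.

Lemma lshape : young_shape lrow lcol lht.
Proof.
split.
- move=> [[b hb] [j hj]] [[b' hb'] [j' hj']]; rewrite /lrow /lcol /= => h1 h2.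
  apply: pos_eq => /=; move: h1 h2;
    case: b hb => [|[|[|//]]] _; case: b' hb' => [|[|[|//]]] _; iflia.
- move=> [[b hb] [j hj]]; rewrite /lrow /lcol /lht /=.
  by case: b hb => [|[|[|//]]] _; iflia.
move=> r c; rewrite /lht => h.
pose b := if c < t - u then r else if c < t then 0 else if c < t + u then 1 else 2.
pose j := if c < t then c else if c < t + u then c - u else c - 2 * u.
have [||x [xb xj]] := @pos_ex b j.
- by move: h; rewrite /b; iflia.
- by move: h; rewrite /j; iflia.
exists x; rewrite /lrow /lcol xb xj /b /j; move: h; iflia.
Qed.

Lemma gsemistd x y : gcol x = gcol y -> (grow x < grow y)%N -> (blk x < blk y)%N.
Proof.
case: x y => [[b hb] [j hj]] [[b' hb'] [j' hj']]; rewrite /blk /grow /gcol /=.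
iflia.
Qed.

Lemma lsemistd x y : lcol x = lcol y -> (lrow x < lrow y)%N -> (blk x < blk y)%N.
Proof.
case: x y => [[b hb] [j hj]] [[b' hb'] [j' hj']]; rewrite /blk /lrow /lcol /=.
case: b hb => [|[|[|//]]] _; case: b' hb' => [|[|[|//]]] _; iflia.
Qed.

Lemma brot'1 x : (brot' x).1 = next x.1 :> nat.
Proof. by apply: mkpos1; have := pos1_lt x; rewrite /next; iflia. Qed.

Lemma brot'2 x : (brot' x).2 = (if x.1 < 2 then half x.2 else x.2) :> nat.
Proof. by apply: mkpos2; have := pos2_lt x; rewrite /half; iflia. Qed.

Lemma mir2 x : (mir x).2 = (if single_pos x then (if x.1 == 0 :> nat then x.2 - u else x.2) else
  if mate_pos x then (if x.2 < t - u then x.2 + u else x.2) else x.2) :> nat.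
Proof.
have := pos2_lt x; rewrite /mir; case: ifP => [_|_] h.
  by rewrite mkpos2 //; iflia.
case: ifP => // _; case: ifP => // h2; rewrite mkpos2 //; lia.
Qed.

Lemma mirK : involutive mir.
Proof.
move=> x; apply: pos_eq; rewrite !(mir1, mir2) /single_pos /mate_pos !(mir1, mir2) /single_pos /mate_pos;
  move: (pos1_lt x) (pos2_lt x); move: (nat_of_ord x.1) (nat_of_ord x.2) => b j; iflia.
Qed.

Lemma brot'_inj : injective brot'.
Proof.
move=> x y e; have := congr1 (fun z : U => z.1 : nat) e; have := congr1 (fun z : U => z.2 : nat) e.
rewrite !brot'1 !brot'2 /next /half => e2 e1; apply: pos_eq;
  move: e1 e2 (pos1_lt x) (pos1_lt y) (pos2_lt x) (pos2_lt y); iflia.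
Qed.

Lemma gcol_rot' x y : (gcol (brot' x) == gcol (brot' y)) = (gcol x == gcol y).
Proof.
rewrite /gcol !brot'1 !brot'2 /next /half.
move: (pos1_lt x) (pos1_lt y) (pos2_lt x) (pos2_lt y).
move: (nat_of_ord x.1) (nat_of_ord x.2) (nat_of_ord y.1) (nat_of_ord y.2) => b j b' j'.
case: b => [|[|[|//]]]; case: b' => [|[|[|//]]] _ _ /=; iflia.
Qed.

Lemma ght_rot' x : ght (gcol (brot' x)) = ght (gcol x).
Proof.
rewrite /ght /gcol !brot'1 !brot'2 /next /half.
move: (pos1_lt x) (pos2_lt x); move: (nat_of_ord x.1) (nat_of_ord x.2) => b j.
case: b => [|[|[|//]]] _ /=; iflia.
Qed.

Lemma lcol_rot x y : (lcol (brot x) == lcol (brot y)) = (lcol x == lcol y).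
Proof.
rewrite /lcol !brot1 !brot2 /next.
move: (pos1_lt x) (pos1_lt y) (pos2_lt x) (pos2_lt y).
move: (nat_of_ord x.1) (nat_of_ord x.2) (nat_of_ord y.1) (nat_of_ord y.2) => b j b' j'.
case: b => [|[|[|//]]]; case: b' => [|[|[|//]]] _ _ /=; iflia.
Qed.

Lemma lht_rot x : lht (lcol (brot x)) = lht (lcol x).
Proof.
rewrite /lht /lcol !brot1 !brot2 /next.
move: (pos1_lt x) (pos2_lt x); move: (nat_of_ord x.1) (nat_of_ord x.2) => b j.
case: b => [|[|[|//]]] _ /=; iflia.
Qed.

Lemma gcol_mir x : gcol (mir x) = gcol x.
Proof.
rewrite /gcol !mir1 !mir2 /single_pos /mate_pos.
move: (pos1_lt x) (pos2_lt x); move: (nat_of_ord x.1) (nat_of_ord x.2) => b j; iflia.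
Qed.

Lemma gcol_eq x y : single_pos x || mate_pos x ->
  (gcol x == gcol y) = (y == x) || (y == mir x).
Proof.
move=> h; apply/eqP/orP => [e|[/eqP ->|/eqP ->]]; rewrite ?gcol_mir //.
suff : ((y.1 == x.1 :> nat) && (y.2 == x.2 :> nat)) ||
       ((y.1 == (mir x).1 :> nat) && (y.2 == (mir x).2 :> nat)).
  by case/orP=> /andP[/eqP e1 /eqP e2]; [left | right]; apply/eqP/pos_eq.
rewrite mir1 mir2; move: e h; rewrite /gcol /single_pos /mate_pos.
move: (pos1_lt x) (pos1_lt y) (pos2_lt x) (pos2_lt y).
move: (nat_of_ord x.1) (nat_of_ord x.2) (nat_of_ord y.1) (nat_of_ord y.2) => b j b' j'.
case: b => [|[|[|//]]]; case: b' => [|[|[|//]]] _ _ /=; iflia.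
Qed.

Lemma lcol_eq x y : single_pos x -> (lcol x == lcol y) = (y == x).
Proof.
move=> h; apply/eqP/eqP => [e|->] //; apply: pos_eq; move: e h; rewrite /lcol /single_pos;
move: (pos1_lt x) (pos1_lt y) (pos2_lt x) (pos2_lt y);
move: (nat_of_ord x.1) (nat_of_ord x.2) (nat_of_ord y.1) (nat_of_ord y.2) => b j b' j';
case: b => [|[|[|//]]]; case: b' => [|[|[|//]]] _ _ /=; iflia.
Qed.

End Tableaux.

(** * Effect of permuting the blocks *)

Section BlockPerms.
Variables (t u : nat).
Local Notation U := ('I_3 * 'I_t)%type.
Hypotheses (u_gt0 : (0 < u)%N) (le_2u_t : (2 * u <= t)%N).
Local Notation single := (single_pos u).
Local Notation mate := (mate_pos u).
Local Notation mir := (mir u).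
Local Notation flip := (flip u).

Definition gsym (k : fieldType) n (T : ten k U n) : ten k U n :=
  young_op false (gcol u) (young_op true (grow u) T).
Definition lsym (k : fieldType) n (T : ten k U n) : ten k U n :=
  young_op false (lcol u) (young_op true (lrow u) T).
Definition balt (k : fieldType) n (T : ten k U n) : ten k U n :=
  young_op true (@blk t) T.

(** [s'] permutes the columns and differs from [s] by a permutation preserving blocks, so [s] acts
    by a sign; as the cube of [s] is 1, the sign can be taken to be 1. *)
Lemma balt_pl_cyclic (row col : U -> nat) (ht : nat -> nat) (s s' : {perm U}) :
  young_shape row col ht ->
  (forall x y, (col (s' x) == col (s' y)) = (col x == col y)) ->
  (forall x, ht (col (s' x)) = ht (col x)) ->
  (forall x, blk (s' x) = blk (s x)) ->
  (forall x y, (blk (s x) == blk (s y)) = (blk x == blk y)) ->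
  (s * s * s = 1)%g ->
  forall (k : fieldType) n (T : ten k U n),
  pl s (balt (young_op false col (young_op true row T))) =
    balt (young_op false col (young_op true row T)).
Proof.
move=> sh sC sH sb sB s3 k n T; have [e He] := pl_column_perm sh sC sH.
set a := balt _.
have bY : (s'^-1 * s)%g \in young (@blk t).
  by apply/youngP=> x; rewrite permM -sb permKV.
have sa : pl s a = (-1) ^+ ((s'^-1 * s)%g (+) e) *: a.
  rewrite /a /balt pl_young_opC // -{1}[s](mulKVg s') -plM young_op_pl //.
  by rewrite He linearZ scalerA signr_addb.
move: sa; case: (_ (+) _) => sa; last by rewrite sa scale1r.
rewrite /= expr1 scaleN1r in sa.
have : pl s (pl s (pl s a)) = a by rewrite !plM ?mulgA s3 pl1.
by rewrite sa !linearN /= sa linearN /= sa opprK.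
Qed.

Definition brot_perm : {perm U} := perm (@brot_inj t).
Definition brot'_perm : {perm U} := perm (brot'_inj u_gt0 le_2u_t).

Lemma brot_perm3 : (brot_perm * brot_perm * brot_perm = 1)%g.
Proof.
apply/perm.permP=> x; rewrite perm1 !permM !permE; apply: pos_eq; rewrite ?brot1 ?brot2 //.
by case: x => [[[|[|[|//]]] ?] ?].
Qed.

Lemma blk_rot x y : (blk (brot_perm x) == blk (brot_perm y)) = (blk x == blk y).
Proof.
rewrite !permE /blk !brot1 /next; move: (pos1_lt x) (pos1_lt y).
by move: (nat_of_ord x.1) (nat_of_ord y.1) => [|[|[|//]]] [|[|[|//]]].
Qed.

Lemma pl_rot_gsym (k : fieldType) n (T : ten k U n) :
  pl brot_perm (balt (gsym T)) = balt (gsym T).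
Proof.
apply: (@balt_pl_cyclic (grow u) (gcol u) (ght t u) _ brot'_perm); rewrite ?brot_perm3 //.
- exact: gshape.
- by move=> x y; rewrite !permE gcol_rot'.
- by move=> x; rewrite !permE ght_rot'.
- by move=> x; rewrite !permE /blk brot'1 // brot1.
- exact: blk_rot.
Qed.

Lemma pl_rot_lsym (k : fieldType) n (T : ten k U n) :
  pl brot_perm (balt (lsym T)) = balt (lsym T).
Proof.
apply: (@balt_pl_cyclic (lrow u) (lcol u) (lht t u) _ brot_perm); rewrite ?brot_perm3 //.
- exact: lshape.
- by move=> x y; rewrite !permE lcol_rot.
- by move=> x; rewrite !permE lht_rot.
- exact: blk_rot.
Qed.

(** Here the singles lie in row 0 and are alone in their columns, so [q] is a row permutation that
    permutes columns. *)
Lemma balt_pl_single_lsym (k : fieldType) n (T : ten k U n) (q : {perm U}) :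
  perm_on [set x | single x] q ->
  balt (pl q (lsym T)) = (-1) ^+ q *: balt (lsym T).
Proof.
move=> q_on; have qS x : single (q x) = single x.
  by have := perm_closed x q_on; rewrite !inE.
have qN x : ~~ single x -> q x = x by move=> h; apply: (out_perm q_on); rewrite inE.
rewrite /balt /lsym pl_row_perm ?linearZ //.
  apply/youngP=> x; have [h|/qN-> //] := boolP (single x).
  have := qS x; rewrite h; move: h; rewrite /single_pos /lrow => /andP[_ h1] /andP[_ h2].
  by rewrite !ltnNge h1 h2.
move=> x y; have [h|nx] := boolP (single x).
  by rewrite !lcol_eq ?qS // (inj_eq perm_inj).
have [h|ny] := boolP (single y); last by rewrite !qN.
by rewrite eq_sym [RHS]eq_sym !lcol_eq ?qS // (inj_eq perm_inj).
Qed.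

(** [q] respects columns only if the mates in block 2 follow. Their permutation [q2] preserves
    blocks, so its sign occurs twice, once through the rows and once through [balt], and only the
    sign of [q] remains. *)
Lemma balt_pl_single_gsym (k : fieldType) n (T : ten k U n) (q : {perm U}) :
  perm_on [set x | single x] q ->
  balt (pl q (gsym T)) = (-1) ^+ q *: balt (gsym T).
Proof.
move=> q_on; have qS x : single (q x) = single x.
  by have := perm_closed x q_on; rewrite !inE.
have qN x : ~~ single x -> q x = x by move=> h; apply: (out_perm q_on); rewrite inE.
have mS (x : U) : single (mir x) = mate x.
  rewrite /single_pos /mate_pos mir1 ?mir2 // /single_pos /mate_pos; move: (pos1_lt x) (pos2_lt x); move: (nat_of_ord x.1) (nat_of_ord x.2) => b j; iflia.
have mS2 (x : U) : mate (mir x) = single x by rewrite -mS mirK.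
have S2 (x : U) : mate x -> ~~ single x.
  by rewrite /single_pos /mate_pos => /andP[/eqP-> _].
pose m : {perm U} := perm (can_inj (mirK u_gt0 le_2u_t)).
have mV : m^-1%g = m.
  by apply/perm.permP=> x; apply: (@perm_inj _ m); rewrite permKV !permE mirK.
pose q2 : {perm U} := (q ^ m)%g.
have q2E x : q2 x = mir (q (mir x)) by rewrite /q2 conjgE mV !permM !permE.
have q2N x : ~~ mate x -> q2 x = x.
  by move=> h; rewrite q2E qN ?mS // mirK.
have q2S x : mate (q2 x) = mate x by rewrite q2E mS2 qS mS.
have qq2 x : (q * q2)%g x = if single x then q x else if mate x then q2 x else x.
  rewrite permM; case: ifP => [h|/negbT h].
    by rewrite q2N //; apply: contraL h => /S2; rewrite qS.
  by rewrite qN //; case: ifP => // /negbT; apply: q2N.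
have q2Y : q2 \in young (@blk t).
  apply/youngP=> x; have [h|/q2N-> //] := boolP (mate x).
  by have := q2S x; rewrite h /blk; move: h => /andP[/eqP-> _] /andP[/eqP-> _].
have qX : pl (q * q2)%g (gsym T) = (-1) ^+ (q * q2)%g *: gsym T.
  rewrite /gsym pl_row_perm //.
    apply/youngP=> x; rewrite qq2; case: ifP => [h|h].
      have := qS x; rewrite h; move: h; rewrite /single_pos /grow.
      move: (pos1_lt x) (pos1_lt (q x)); iflia.
    case: ifP => // h2; have := q2S x; rewrite h2; move: h2; rewrite /mate_pos /grow.
    move: (pos1_lt x) (pos1_lt (q2 x)); iflia.
  pose W (x : U) := single x || mate x.
  have mW x : W (mir x) = W x by rewrite /W mS mS2 orbC.
  have qW x : W ((q * q2)%g x) = W x.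
    rewrite qq2 /W; case: ifP => [h|h]; first by rewrite qS h.
    by case: ifP => h2; rewrite ?q2S ?h ?h2 ?orbT.
  have qm x : (q * q2)%g (mir x) = mir ((q * q2)%g x).
    rewrite !qq2 mS mS2; have [h|h] := boolP (single x).
      by rewrite (negPf (contraL (@S2 x) h)) q2E mirK.
    by case: ifP => // h2; rewrite q2E mirK.
  move=> x y; have [h|nx] := boolP (W x).
    rewrite !gcol_eq -/(W _) ?qW // -qm !(inj_eq perm_inj) //.
  have [h|ny] := boolP (W y).
    rewrite eq_sym [RHS]eq_sym !gcol_eq -/(W _) ?qW // -qm !(inj_eq perm_inj) //.
  by move: nx ny; rewrite /W !negb_or => /andP[n1 n2] /andP[n3 n4];
     rewrite !qq2 !ifN.
rewrite -{1}[q](mulgK q2) -plM qX linearZ /= /balt linearZ /= young_op_pl ?youngV //.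
by rewrite scalerA odd_permV odd_permM signr_addb -mulrA -signr_addb addbb mulr1.
Qed.

(** When this fails, two positions of one column reach one block and [balt] kills the tensor, for
    both tableaux. *)
Definition splits (s : {perm U}) :=
  [forall x, paired u x ==> (blk (s (flip x)) != blk (s x))].

Definition low : {set U} := [set x : U | (x.1 < 2)%N].

Lemma balt_pl_nsplit (s : {perm U}) : ~~ splits s ->
  (forall (k : fieldType) n (T : ten k U n), 2%:R != 0 :> k -> balt (pl s (gsym T)) = 0) /\
  (forall (k : fieldType) n (T : ten k U n), 2%:R != 0 :> k -> balt (pl s (lsym T)) = 0).
Proof.
rewrite negb_forall => /existsP[x]; rewrite negb_imply negbK => /andP[px /eqP eb].
have nx : flip x != x.
  apply/eqP=> /(congr1 (fun z : U => z.1 : nat)); rewrite flip1 px.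
  by move: px => /andP[h _]; lia.
split=> k n T k2; rewrite /balt.
  by apply: (alt_sym_eq0 _ k2 nx); rewrite ?gcol_flip.
by apply: (alt_sym_eq0 _ k2 nx); rewrite ?lcol_flip.
Qed.

Lemma splits1 : splits 1%g.
Proof.
apply/forallP=> x; apply/implyP=> px; rewrite !perm1 /blk flip1 px.
by move: px => /andP[h _]; lia.
Qed.

(* A permutation separating all pairs factors as [p q b], where [p] swaps some
   pairs, [q] permutes the singles and [b] preserves the blocks. *)
Lemma balt_pl_splits (s : {perm U}) : perm_on low s -> splits s ->
  exists e : bool,
  (forall (k : fieldType) n (T : ten k U n),
     balt (pl s (gsym T)) = (-1) ^+ e *: balt (gsym T)) /\
  (forall (k : fieldType) n (T : ten k U n),
     balt (pl s (lsym T)) = (-1) ^+ e *: balt (lsym T)).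
Proof.
move=> s_on /forallP spl.
have sl x : ((s x).1 < 2)%N = (x.1 < 2)%N by have := perm_closed x s_on; rewrite !inE.
have sN (x : U) : ~~ (x.1 < 2)%N -> s x = x by move=> h; apply: (out_perm s_on); rewrite inE.
have pflip (x : U) : paired u (flip x) = paired u x.
  by rewrite {1}/paired flip1 flip2 /paired; case: ifP => //; lia.
have sep (x : U) : paired u x -> blk (s (flip x)) = (1 - blk (s x))%N.
  move=> px; have := implyP (spl x) px.
  have := sl (flip x); have := sl x; have /andP[-> _] := px.
  have : paired u (flip x) by rewrite pflip.
  case/andP=> -> _; rewrite /blk /=; lia.
pose p (x : U) := if paired u x && (blk (s x) != blk x) then flip x else x.
have pK : involutive p.
  move=> x; rewrite {2}/p; case: ifP => [/andP[px nb]|h]; last by rewrite /p h.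
  rewrite /p pflip px flipK sep // /blk flip1 px ifT //.
  by have := sl x; move: px nb => /andP[h1 _]; rewrite h1 /blk /=; lia.
pose pp : {perm U} := perm (can_inj pK).
pose L (y : U) := blk (s (p y)).
have LN (y : U) : ~~ single y -> L y = blk y.
  move=> ny; rewrite /L /p; have [px|npx] := boolP (paired u y).
    case: eqP => //= nb; rewrite sep //.
    by have := sl y; move: px nb => /andP[h1 _]; rewrite h1 /blk /=; lia.
  rewrite sN //; move: ny npx; rewrite /single_pos /paired; lia.
(* After the flips [p], the labels [L] agree with the blocks off the singles. Over all positions [L]
   takes each value as often as [blk] does, hence also on the singles. *)
have [|q q_on qL] := @relabel _ _ [set x : U | single x] (@blk t) L.
  move=> c; pose S := [set x : U | single x].
  have cE (f : U -> nat) : #|[set x in S | f x == c]| = #|[set x | f x == c] :&: S|.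
    by apply: eq_card => x; rewrite !inE andbC.
  rewrite !cE; apply/eqP; rewrite -(eqn_add2r #|[set x | L x == c] :\: S|).
  rewrite cardsID (_ : [set x | L x == c] :\: S = [set x | blk x == c] :\: S); last first.
    by apply/setP=> x; rewrite !inE; have [//|nx] := boolP (single x); rewrite LN.
  rewrite cardsID; apply/eqP.
  rewrite -(card_preimset [set x | blk x == c] (@perm_inj _ (pp * s)%g)).
  by apply: eq_card => x; rewrite !inE permM permE.
have bL y : blk (q y) = L y.
  have [h|nh] := boolP (single y); first by rewrite qL ?inE.
  by rewrite (out_perm q_on) ?inE // LN.
have bY : ((pp * q)^-1 * s)%g \in young (@blk t).
  apply/youngP=> x; rewrite permM -{2}[x](permKV (pp * q)%g); set y := ((pp * q)^-1)%g x.
  by rewrite permM bL /L permE pK.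
have sE : s = (pp * q * ((pp * q)^-1 * s))%g by rewrite mulKVg.
move: (_^-1 * s)%g bY sE => b bY sE; exists (b (+) q).
have pY (l : U -> nat) : (forall x, l (flip x) = l x) -> pp \in young l.
  by move=> h; apply/youngP=> x; rewrite permE /p; case: ifP; rewrite ?h.
split=> k n T; rewrite sE -!plM /balt young_op_pl // -/(balt _) signr_addb -scalerA.
  rewrite -balt_pl_single_gsym // [pl pp _]pl_young_op ?scale1r //.
  exact/pY/gcol_flip.
rewrite -balt_pl_single_lsym // [pl pp _]pl_young_op ?scale1r //.
exact/pY/lcol_flip.
Qed.

End BlockPerms.

(** * Variables and relations of minors *)

Section SubDet.
Variables (t : nat).

Definition sdet (A : comNzRingType) (m n : nat) (M : 'M[A]_(m, n))
  (p : {ffun 'I_t -> 'I_m}) (q : {ffun 'I_t -> 'I_n}) : A := \det (mxsub p q M).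

Lemma sdet_tr (A : comNzRingType) m n (M : 'M[A]_(m, n)) p q :
  sdet M^T q p = sdet M p q.
Proof. by rewrite /sdet -[RHS]det_tr; congr (\det _); apply/matrixP=> i j; rewrite !mxE. Qed.

Lemma sdet_perml (A : comNzRingType) m n (M : 'M[A]_(m, n)) p q (s : 'S_t) :
  sdet M (comp_perm s p) q = (-1) ^+ s * sdet M p q.
Proof.
rewrite /sdet (_ : mxsub _ _ _ = row_perm s (mxsub p q M)).
  by rewrite row_permE det_mulmx det_perm.
by apply/matrixP=> i j; rewrite !mxE ffunE.
Qed.

Lemma sdet_permr (A : comNzRingType) m n (M : 'M[A]_(m, n)) p q (s : 'S_t) :
  sdet M p (comp_perm s q) = (-1) ^+ s * sdet M p q.
Proof. by rewrite -sdet_tr sdet_perml sdet_tr. Qed.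

Lemma incrP m (I : incr t m) (a b : 'I_t) : (a < b)%N -> (val I a < val I b)%N.
Proof. by move: (valP I) => /forallP/(_ a)/forallP/(_ b)/implyP. Qed.

(** A permutation between increasing sequences is itself increasing, hence trivial. *)
Lemma incr_perm m (I J : incr t m) (s : 'S_t) :
  comp_perm s (val J) = val I -> s = 1%g /\ I = J.
Proof.
move=> e.
have s_mono (a b : 'I_t) : (a < b)%N -> (s a < s b)%N.
  move=> ab; have := incrP I ab; rewrite -e !ffunE.
  case: (ltngtP (s a) (s b)) => // [/(incrP J)|/val_inj->]; last by rewrite ltnn.
  by move=> h1 h2; have := ltn_trans h1 h2; rewrite ltnn.
have s_ge (v : nat) : forall a : 'I_t, a = v :> nat -> (a <= s a)%N.
  elim: v => [|v IH] a av; first by rewrite av.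
  have vt : (v < t)%N by apply: ltn_trans (ltn_ord a); rewrite av.
  have := IH (Ordinal vt) erefl; rewrite /= av => h.
  by apply: leq_ltn_trans h (s_mono _ _ _); rewrite /= av.
have s_eq : s = 1%g.
  apply/perm.permP=> x; rewrite perm1; apply/val_inj/eqP => /=.
  have h : forall a : 'I_t, true -> (a <= s a ?= iff (s a == a))%N.
    move=> a _; apply/leqifP; case: eqP => [->//|ne].
    by rewrite ltn_neqAle (s_ge a) // andbT; apply/eqP=> /val_inj /esym.
  have [_] := leqif_sum h; rewrite [X in (X == _)%N](reindex_inj (@perm_inj _ s)) eqxx.
  by move/esym/forallP/(_ x).
by split=> //; apply/val_inj; rewrite -e s_eq comp_perm1.
Qed.

Lemma sort_incr m (p : {ffun 'I_t -> 'I_m}) : injective p ->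
  exists (I : incr t m) (s : 'S_t), p = comp_perm s (val I).
Proof.
move=> p_inj; pose leo := relpre (@nat_of_ord m) leq.
pose tp := [tuple p a | a < t].
have [s sE] : exists s : 'S_t, sort leo tp = [tuple tnth tp (s a) | a < t].
  by apply/tuple_permP; rewrite perm_sort.
pose f := comp_perm s p.
have fE a : nth (p a) (sort leo tp) a = f a.
  by rewrite sE nth_mktuple tnth_mktuple ffunE.
have f_inj : injective f by move=> a b; rewrite !ffunE => /p_inj /perm_inj.
have leo_total : total leo by move=> x y; apply: leq_total.
have leo_trans : transitive leo by move=> x y z; apply: leq_trans.
have f_incr : [forall a : 'I_t, forall b : 'I_t, (a < b)%N ==> (f a < f b)%N].
  apply/forallP=> a; apply/forallP=> b; apply/implyP=> ab.
  have := sorted_ltn_nth leo_trans (p a) (sort_sorted leo_total tp).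
  move/(_ a b); rewrite !inE size_sort size_tuple !ltn_ord => /(_ isT isT ab).
  rewrite fE (set_nth_default (p b)) ?size_sort ?size_tuple // fE /leo /= => h.
  rewrite ltn_neqAle h andbT; apply/eqP=> /val_inj /f_inj eab.
  by rewrite eab ltnn in ab.
exists (exist _ f f_incr), s^-1%g.
by rewrite /= comp_permM mulVg comp_perm1.
Qed.

Section Alternating.
Variables (k : fieldType) (V : lmodType k) (m : nat) (F : {ffun 'I_t -> 'I_m} -> V).
Hypothesis k2 : 2%:R != 0 :> k.
Hypothesis F_alt : forall (s : 'S_t) p, F (comp_perm s p) = (-1) ^+ s *: F p.

Lemma alt_noninj (p : {ffun 'I_t -> 'I_m}) : ~~ injectiveb p -> F p = 0.
Proof.
case/injectivePn=> x [y nxy e].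
have h : F p = - F p.
  rewrite -{1}(_ : comp_perm (tperm x y) p = p) ?F_alt ?odd_tperm ?nxy ?scaleN1r //.
  by apply/ffunP=> z; rewrite ffunE; case: tpermP => [->|->|].
have : 2%:R *: F p = 0 by rewrite scaler_nat mulr2n {1}h addNr.
by move/eqP; rewrite scaler_eq0 (negPf k2) => /eqP.
Qed.

End Alternating.

Lemma sdet1_incr (A : comNzRingType) m (I J : incr t m) :
  sdet (1%:M : 'M[A]_m) (val I) (val J) = (I == J)%:R.
Proof.
rewrite /sdet /determinant (bigD1 1%g) //= [X in _ + X]big1 ?addr0 => [|s ns].
  rewrite odd_perm1 mul1r; have [->|nIJ] := eqVneq I J.
    by rewrite big1 // => a _; rewrite !mxE perm1 eqxx.
  have [a na] : exists a, val I a != val J a.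
    apply/existsP; apply: contraNT nIJ => /existsPn h; apply/eqP/val_inj/ffunP=> a.
    by apply/eqP; have := h a; rewrite negbK.
  by rewrite (bigD1 a) //= !mxE perm1 (negPf na) mul0r.
have [a na] : exists a, val I a != val J (s a).
  apply/existsP; apply: contraNT ns => /existsPn h; apply/eqP.
  have [|-> //] := @incr_perm m I J s.
  by apply/ffunP=> a; rewrite ffunE; apply/esym/eqP; have := h a; rewrite negbK.
by rewrite (bigD1 a) //= !mxE (negPf na) mul0r mulr0.
Qed.

(** The minor of the identity is the sign of the sorting of [p] into [I], or 0: an alternating
    function is recovered from its values at increasing sequences. *)
Lemma sum_incr_alt (k : fieldType) (V : lmodType k) m (F : {ffun 'I_t -> 'I_m} -> V) p :
  2%:R != 0 :> k ->
  (forall (s : 'S_t) p, F (comp_perm s p) = (-1) ^+ s *: F p) ->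
  \sum_(I : incr t m) sdet (1%:M : 'M[k]_m) (val I) p *: F (val I) = F p.
Proof.
move=> k2 F_alt; pose G p := \sum_(I : incr t m) sdet (1%:M : 'M[k]_m) (val I) p *: F (val I).
have G_alt (s : 'S_t) q : G (comp_perm s q) = (-1) ^+ s *: G q.
  by rewrite scaler_sumr; apply: eq_bigr => I _; rewrite sdet_permr scalerA.
rewrite -/(G p); have [/injectiveP p_inj|np] := boolP (injectiveb p); last first.
  by rewrite (alt_noninj k2 F_alt np) (alt_noninj k2 G_alt np).
have [J [s ->]] := sort_incr p_inj; rewrite G_alt F_alt; congr (_ *: _).
rewrite /G (bigD1 J) //= sdet1_incr eqxx scale1r big1 ?addr0 // => I /negPf nI.
by rewrite sdet1_incr nI scale0r.
Qed.

(** Multilinearity of the determinant in its columns. *)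
Lemma sum_ffun_sdet (A : comNzRingType) m n l (a : 'M[A]_(m, n)) (b : 'M[A]_(l, m))
    P (p : {ffun 'I_t -> 'I_n}) :
  \sum_(p' : {ffun 'I_t -> 'I_m}) (\prod_x a (p' x) (p x)) * sdet b P p' =
    sdet (b *m a) P p.
Proof.
rewrite /sdet /determinant; under eq_bigr do rewrite mulr_sumr.
rewrite exchange_big /=; apply: eq_bigr => s _; under eq_bigr do rewrite mulrCA.
rewrite -mulr_sumr; congr (_ * _).
under [RHS]eq_bigr do rewrite !mxE.
rewrite bigA_distr_bigA /= (reindex_inj (@comp_perm_inj _ _ s^-1%g)) /=.
apply: eq_bigr => f _; rewrite (reindex_inj (@perm_inj _ s)) -big_split /=.
by apply: eq_bigr => i _; rewrite !mxE !ffunE permK mulrC.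
Qed.

End SubDet.

(** * Variables indexed by arbitrary sequences of rows and columns *)

Section MinorVariables.
Variables (k : fieldType) (t m n : nat).
Hypothesis k2 : 2%:R != 0 :> k.
Local Notation S := (polyS k t m n).
Local Notation R := (polyR k m n).
Local Notation idx := 'I_(#|{: minor_idx t m n}|).

Lemma minor_map_var (I : incr t m) (J : incr t n) :
  minor_map (minor_var k I J) = minor (generic_mx k m n) I J.
Proof.
by rewrite /minor_map /minor_var comp_mpolyXU -tnth_nth tnth_mktuple enum_rankK.
Qed.

Lemma actS_var a b (I : incr t m) (J : incr t n) :
  actS a b (minor_var k I J) =
  \sum_(P : incr t m) \sum_(Q : incr t n)
     (sdet a (val P) (val I) * sdet (invmx b) (val J) (val Q)) *: minor_var k P Q.
Proof.
by rewrite /actS /minor_var comp_mpolyXU -tnth_nth tnth_mktuple enum_rankK.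
Qed.

(* The variable of the minor with arbitrary (not necessarily increasing) rows
   [p] and columns [q]. *)
Definition xvar (p : {ffun 'I_t -> 'I_m}) (q : {ffun 'I_t -> 'I_n}) : S :=
  \sum_(I : incr t m) \sum_(J : incr t n)
    (sdet 1%:M (val I) p * sdet 1%:M (val J) q) *: minor_var k I J.

Lemma minor_map_xvar p q : minor_map (xvar p q) = sdet (generic_mx k m n) p q.
Proof.
rewrite /minor_map /xvar raddf_sum /=.
under eq_bigr => I _.
  rewrite raddf_sum /=; under eq_bigr => J _ do
    rewrite linearZ /= -/(minor_map _) minor_map_var -[minor _ _ _]/(sdet _ _ _) -scalerA.
  rewrite -scaler_sumr (sum_incr_alt (F := fun q => sdet (generic_mx k m n) (val I) q)) //; last first.
    by move=> s q'; rewrite sdet_permr mulr_sign scaler_sign.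
  over.
rewrite /= (sum_incr_alt (F := fun p => sdet (generic_mx k m n) p q)) //.
by move=> s p'; rewrite sdet_perml mulr_sign scaler_sign.
Qed.

Lemma sum_xvar (w : {ffun 'I_t -> 'I_m} -> {ffun 'I_t -> 'I_n} -> k) :
  \sum_p \sum_q w p q *: xvar p q =
  \sum_(I : incr t m) \sum_(J : incr t n)
    (\sum_p \sum_q w p q * (sdet 1%:M (val I) p * sdet 1%:M (val J) q)) *: minor_var k I J.
Proof.
under eq_bigr => p _.
  under eq_bigr => q _ do rewrite scaler_sumr.
  rewrite exchange_big; over.
rewrite exchange_big; apply: eq_bigr => I _ /=.
under eq_bigr => p _.
  under eq_bigr => q _ do rewrite scaler_sumr.
  rewrite exchange_big; over.
rewrite exchange_big; apply: eq_bigr => J _ /=.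
rewrite scaler_suml; apply: eq_bigr => p _.
by rewrite scaler_suml; apply: eq_bigr => q _; rewrite scalerA.
Qed.

(** With arbitrary sequences the action becomes that of a tensor power, as on the Schur modules,
    without minors. *)
Lemma actS_xvar a b p q :
  actS a b (xvar p q) =
  \sum_(p' : {ffun 'I_t -> 'I_m}) \sum_(q' : {ffun 'I_t -> 'I_n})
    ((\prod_x a (p' x) (p x)) * (\prod_x invmx b (q x) (q' x))) *: xvar p' q'.
Proof.
pose G P Q := (sdet a (val P) p * sdet (invmx b) q (val Q)) *: minor_var k P Q.
transitivity (\sum_P \sum_Q G P Q).
  rewrite /actS /xvar raddf_sum /=.
  under eq_bigr => I _.
    rewrite raddf_sum /=; under eq_bigr => J _ do
      rewrite linearZ /= -/(actS a b _) actS_var scaler_sumr.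
    rewrite exchange_big /=; over.
  rewrite exchange_big; apply: eq_bigr => P _ /=.
  under eq_bigr do under eq_bigr do rewrite scaler_sumr.
  under eq_bigr do rewrite exchange_big.
  rewrite exchange_big /=; apply: eq_bigr => Q _; rewrite /G.
  have -> : sdet a (val P) p = \sum_(I : incr t m) sdet 1%:M (val I) p * sdet a (val P) (val I).
    by apply/esym/(@sum_incr_alt _ _ k^o _ (sdet a (val P))) => // s q'; rewrite sdet_permr.
  have -> : sdet (invmx b) q (val Q) =
      \sum_(J : incr t n) sdet 1%:M (val J) q * sdet (invmx b) (val J) (val Q).
    by apply/esym/(@sum_incr_alt _ _ k^o _ (fun q => sdet (invmx b) q (val Q))) => // s q';
      rewrite sdet_perml.
  rewrite mulr_suml scaler_suml; apply: eq_bigr => I _.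
  rewrite mulr_sumr scaler_suml; apply: eq_bigr => J _.
  by rewrite scalerA mulrACA.
rewrite sum_xvar; apply: eq_bigr => P _; apply: eq_bigr => Q _; rewrite /G; congr (_ *: _).
rewrite -[a]mul1mx -sum_ffun_sdet -sdet_tr -[(invmx b)^T]mul1mx -sum_ffun_sdet.
rewrite mulr_suml; apply: eq_bigr => p' _; rewrite mulr_sumr; apply: eq_bigr => q' _.
rewrite mulrACA mul1mx; congr (_ * _ * _).
by apply: eq_bigr => x _; rewrite mxE.
Qed.

Lemma xvar_homog p q : xvar p q \is 1.-homog.
Proof.
rewrite rpred_sum // => I _; rewrite rpred_sum // => J _.
by rewrite rpredZ // dhomogX /= mdeg1.
Qed.

End MinorVariables.

(** * Monomials in the entries of the generic matrix *)

Section GenericMonomials.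
Variables (k : fieldType) (m n : nat) (B : finType) (D : {set B}).
Implicit Types (f : {ffun B -> 'I_m}) (g : {ffun B -> 'I_n}).

Definition mon_exp f g : 'X_{1..m * n} :=
  (\sum_(x in D) U_(mxvec_index (f x) (g x)))%MM.

Lemma prod_generic f g :
  \prod_(x in D) generic_mx k m n (f x) (g x) = 'X_[mon_exp f g].
Proof.
rewrite /mon_exp (big_morph (fun M => 'X_[k, M]) (id1 := 1) (op1 := *%R)).
- by apply: eq_bigr => x _; rewrite mxE.
- by move=> M M'; rewrite mpolyXD.
- exact: mpolyX0.
Qed.

Lemma mxvec_index_inj (i i' : 'I_m) (j j' : 'I_n) :
  mxvec_index i j = mxvec_index i' j' -> i = i' /\ j = j'.
Proof.
by rewrite /mxvec_index => /cast_ord_inj /enum_rank_inj [-> ->].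
Qed.

Lemma mon_exp_perm f g f' g' : mon_exp f g = mon_exp f' g' ->
  {in ~: D, f =1 f'} -> {in ~: D, g =1 g'} ->
  exists2 s : {perm B}, perm_on D s & comp_perm s f = f' /\ comp_perm s g = g'.
Proof.
move=> e ef eg.
have [|s s_on sE] := @relabel _ _ D (fun x => mxvec_index (f x) (g x))
    (fun x => mxvec_index (f' x) (g' x)).
  move=> c; have := congr1 (fun M : 'X_{1..m * n} => M c) e.
  rewrite /mon_exp !mnm_sumE.
  have cE (h : B -> 'I_(m * n)) :
      (\sum_(x in D) U_(h x)%MM c = #|[set x in D | h x == c]|)%N.
    rewrite -sum1_card [RHS](eq_bigl (fun x => (x \in D) && (h x == c))) => [|x]; last by rewrite inE.
    by rewrite [RHS]big_mkcondr /=; apply: eq_bigr => x _; rewrite mnm1E; case: eqP.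
  by rewrite !cE.
exists s => //; split; apply/ffunP=> x; rewrite ffunE.
  have [xD|nxD] := boolP (x \in D); first by have [] := mxvec_index_inj (sE x xD).
  by rewrite (out_perm s_on) // ef // inE.
have [xD|nxD] := boolP (x \in D); first by have [] := mxvec_index_inj (sE x xD).
by rewrite (out_perm s_on) // eg // inE.
Qed.

(* A monomial determines its family of factors up to a permutation, so that
   the sum of [G] over the orderings of the factors is a well-defined linear
   functional of the monomial. *)
Lemma mon_relation (A : finType) (c : A -> k) (f : A -> {ffun B -> 'I_m})
    (g : A -> {ffun B -> 'I_n}) (G : {ffun B -> 'I_m} -> {ffun B -> 'I_n} -> k) :
  (forall y y', {in ~: D, f y =1 f y'}) -> (forall y y', {in ~: D, g y =1 g y'}) ->
  \sum_y c y *: \prod_(x in D) generic_mx k m n (f y x) (g y x) = 0 ->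
  \sum_y c y * \sum_(s : {perm B} | perm_on D s) G (comp_perm s (f y)) (comp_perm s (g y)) = 0.
Proof.
move=> ef eg rel; pose N y := mon_exp (f y) (g y).
pose F y := \sum_(s : {perm B} | perm_on D s) G (comp_perm s (f y)) (comp_perm s (g y)).
have FN y y' : N y = N y' -> F y = F y'.
  move=> e; rewrite /F; have [s s_on [<- <-]] := mon_exp_perm e (ef y y') (eg y y').
  rewrite [LHS](reindex_inj (mulIg s)) /=; apply: eq_big => s'.
    apply/idP/idP => h; last exact: perm_onM.
    by rewrite -[s'](mulgK s) perm_onM ?perm_onV.
  by rewrite !comp_permM.
(* [r] picks one representative per monomial. Inside a group the functional is constant and the
   coefficients add up to a coefficient of the relation, which is 0. *)
pose r y := odflt y [pick y' | N y' == N y].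
have Nr y : N (r y) = N y by rewrite /r; case: pickP => [y' /eqP|].
have r_eq y y' : (r y == r y') = (N y == N y').
  apply/eqP/eqP => [e|e]; first by rewrite -Nr e Nr.
  have : [pick z | N z == N y] = [pick z | N z == N y'] by apply: eq_pick => z; rewrite e.
  by rewrite /r; case: pickP => [z _ <- //|/(_ y)]; rewrite eqxx.
rewrite (partition_big r predT) //= big1 // => z _.
case: (pickP (fun y => r y == z)) => [y0 /eqP zE|none]; last by rewrite big_pred0.
rewrite (eq_big (fun y => N y == N y0) (fun y => c y * F y0)); last 2 first.
- by move=> y; rewrite -zE r_eq.
- by move=> y; rewrite -zE r_eq => /eqP/FN Fy; congr (_ * _).
rewrite -mulr_suml; have := congr1 (fun P => P@_(N y0)) rel.
rewrite mcoeff0 raddf_sum /= [X in X = 0 -> _](_ : _ = \sum_(y | N y == N y0) c y).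
  by move=> ->; rewrite mul0r.
rewrite [RHS]big_mkcond; apply: eq_bigr => y _.
by rewrite mcoeffZ prod_generic mcoeffX -/(N y); case: eqP; rewrite ?mulr1 ?mulr0.
Qed.

End GenericMonomials.

Lemma mcoeff_pihomog (k : fieldType) (l d : nat) (u : {mpoly k[l]}) m :
  (pihomog mdeg d u)@_m = if mdeg m == d then u@_m else 0.
Proof.
case: eqP => [e|/eqP ne]; last exact: (dhomog_nemf_coeff (pihomogP _ _ _) ne).
rewrite [in RHS](mpolyE u) pihomogE !raddf_sum /= big_mkcond /=.
apply: eq_bigr => m' _; case: ifP => // nd; rewrite mcoeffZ mcoeffX.
by case: eqP => [em|]; rewrite ?mulr0 //; rewrite em e eqxx in nd.
Qed.

Lemma dhomog_prod_exp (k : fieldType) (l : nat) (I : finType) (P : pred I)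
    (F : I -> {mpoly k[l]}) (d e : I -> nat) :
  (forall i, F i \is (d i).-homog) ->
  \prod_(i | P i) F i ^+ e i \is (\sum_(i | P i) d i * e i)%N.-homog.
Proof.
move=> h; elim/big_ind2: _ => [|p1 d1 p2 d2|i _]; first exact: dhomog1.
  exact: dhomogM.
exact: dhomogMn.
Qed.

(** * Low-degree parts of relations among minors *)

Section Relations.
Variables (k : fieldType) (t m n : nat).
Hypotheses (char0 : [pchar k] =i pred0) (t_gt0 : (0 < t)%N).
Local Notation S := (polyS k t m n).
Local Notation R := (polyR k m n).
Local Notation idx := 'I_(#|{: minor_idx t m n}|).

Definition minor_rows (i : idx) : {ffun 'I_t -> 'I_m} := val (enum_val i).1.
Definition minor_cols (i : idx) : {ffun 'I_t -> 'I_n} := val (enum_val i).2.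
Definition minor_of (i : idx) : R := sdet (generic_mx k m n) (minor_rows i) (minor_cols i).

Lemma sdet_genericE (p : {ffun 'I_t -> 'I_m}) (q : {ffun 'I_t -> 'I_n}) :
  sdet (generic_mx k m n) p q =
  \sum_(s : 'S_t) (-1) ^+ s *:
    \prod_(a in [set: 'I_t]) generic_mx k m n (p a) (comp_perm s q a).
Proof.
apply: eq_bigr => s _; rewrite mulr_sign scaler_sign.
by congr (if _ then - _ else _); apply: eq_big => [a|a _]; rewrite ?inE ?mxE ?ffunE.
Qed.

Lemma minor_homog (p : {ffun 'I_t -> 'I_m}) (q : {ffun 'I_t -> 'I_n}) :
  sdet (generic_mx k m n) p q \is t.-homog.
Proof.
rewrite sdet_genericE rpred_sum // => s _; rewrite rpredZ // prod_generic dhomogX /=.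
rewrite mdeg_sum (eq_bigr (fun=> 1%N)) => [|x _]; last by rewrite mdeg1.
by rewrite sum1_card cardsT card_ord.
Qed.

Lemma minor_mapX (M : 'X_{1..#|{: minor_idx t m n}|}) :
  minor_map ('X_[M] : S) = \prod_i minor_of i ^+ M i.
Proof. by rewrite /minor_map comp_mpolyX; apply: eq_bigr => i _; rewrite tnth_mktuple. Qed.

Lemma minor_mapX_homog (M : 'X_{1..#|{: minor_idx t m n}|}) :
  minor_map ('X_[M] : S) \is (t * mdeg M)%N.-homog.
Proof.
rewrite minor_mapX mdegE big_distrr /=; apply: dhomog_prod_exp => i; exact: minor_homog.
Qed.

(** Degrees are multiplied by [t], and [t > 0] keeps distinct degrees apart; hence the ideal of
    relations is homogeneous. *)
Lemma minor_map_pihomog d (u : S) :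
  minor_map (pihomog mdeg d u) = pihomog mdeg (t * d) (minor_map u).
Proof.
pose mm := comp_mpoly [tuple minor (generic_mx k m n) (enum_val v).1 (enum_val v).2
  | v < #|{: minor_idx t m n}|] : {linear S -> R}.
have key (f : {linear S -> R}) : f u = \sum_(M <- msupp u) u@_M *: f 'X_[M].
  by rewrite {1}[u]mpolyE linear_sum; apply: eq_bigr => M _; rewrite linearZ.
rewrite -[LHS]/((mm \o pihomog mdeg d) u) -[RHS]/((pihomog mdeg (t * d) \o mm) u).
rewrite !key; apply: eq_bigr => M _; congr (_ *: _) => /=.
rewrite pihomogX -[mm 'X_[M]]/(minor_map 'X_[M]).
case: eqP => [<-|/eqP ne]; first by rewrite pihomog_dE ?minor_mapX_homog.
rewrite linear0; apply/esym/(pihomog_ne0 _ (minor_mapX_homog M)).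
by rewrite eqn_pmul2l // eq_sym.
Qed.

Lemma in_J_pihomog d (u : S) : in_J u -> in_J (pihomog mdeg d u).
Proof. by move=> uJ; rewrite /in_J minor_map_pihomog uJ pihomog0. Qed.

Lemma in_J_coeff0 (u : S) : in_J u -> u@_0%MM = 0.
Proof.
move=> /(in_J_pihomog 0); rewrite /in_J (_ : pihomog _ _ _ = (u@_0%MM)%:MP).
  rewrite /minor_map comp_mpolyC => /(congr1 (fun P => P@_0%MM)).
  by rewrite mcoeffC eqxx mulr1 mcoeff0.
apply/mpolyP=> M; rewrite mcoeff_pihomog mcoeffC mdeg_eq0 eq_sym.
by case: eqP => [<-|]; rewrite ?mulr1 ?mulr0.
Qed.

Lemma two_neq0 : 2%:R != 0 :> k.
Proof. by rewrite ((pcharf0P k).1 char0). Qed.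

Lemma in_J_coeff1 (u : S) i : in_J u -> u@_U_(i)%MM = 0.
Proof.
move=> /(in_J_pihomog 1).
have -> : pihomog mdeg 1 u = \sum_j u@_U_(j)%MM *: 'X_j :> S.
  apply/mpolyP=> M; rewrite mcoeff_pihomog raddf_sum /=.
  case: mdeg1P => [[j /eqP ->]|nM].
    rewrite (bigD1 j) //= mcoeffZ mcoeffX eqxx mulr1 big1 ?addr0 // => j' nj.
    by rewrite mcoeffZ mcoeffXU (negPf nj) mulr0.
  rewrite big1 // => j _; rewrite mcoeffZ mcoeffX; case: eqP => [e|]; last by rewrite mulr0.
  by case: nM; exists j; rewrite e.
rewrite /in_J /minor_map raddf_sum /= => rel.
pose A := (idx * 'S_t)%type.
(* Selects the diagonal monomial of the minor [i]. As its rows and columns increase, it arises from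
   no other minor and no other term of this one. *)
pose G (p : {ffun 'I_t -> 'I_m}) (q : {ffun 'I_t -> 'I_n}) : k :=
  ((p == minor_rows i) && (q == minor_cols i))%:R.
have e0 : \sum_(y : A) u@_U_(y.1)%MM * (-1) ^+ y.2 *
    \sum_(s : 'S_t | perm_on [set: 'I_t] s)
      G (comp_perm s (minor_rows y.1)) (comp_perm s (comp_perm y.2 (minor_cols y.1))) = 0.
  apply: (@mon_relation k m n _ [set: 'I_t] A (fun y => u@_U_(y.1)%MM * (-1) ^+ y.2)
    (fun y => minor_rows y.1) (fun y => comp_perm y.2 (minor_cols y.1)) G) => [y y' x|y y' x|].
  - by rewrite !inE.
  - by rewrite !inE.
  rewrite -[RHS]rel -(pair_bigA _ (fun (j : idx) (s : 'S_t) => (u@_U_(j)%MM * (-1) ^+ s) *: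
    \prod_(x in [set: 'I_t]) generic_mx k m n (minor_rows j x) (comp_perm s (minor_cols j) x))) /=.
  apply: eq_bigr => j _; rewrite linearZ /= -/(minor_map 'X_j).
  have -> : minor_map ('X_j : S) = minor_of j.
    rewrite minor_mapX (bigD1 j) //= mnm1E eqxx big1 ?mulr1 // => j' nj.
    by rewrite mnm1E eq_sym (negPf nj).
  by rewrite /minor_of sdet_genericE scaler_sumr; apply: eq_bigr => s _; rewrite scalerA.
rewrite -[RHS]e0 (bigD1 (i, 1%g)) //= (bigD1 (1%g : 'S_t)) /=; last exact: perm_on1.
rewrite !comp_perm1 /G !eqxx odd_perm1 !mulr1.
have inc (j j' : idx) (s : 'S_t) : comp_perm s (minor_rows j) = minor_rows j' ->
    s = 1%g /\ (enum_val j).1 = (enum_val j').1 by move=> /incr_perm [-> ->].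
have inc' (j j' : idx) (s : 'S_t) : comp_perm s (minor_cols j) = minor_cols j' ->
    s = 1%g /\ (enum_val j).2 = (enum_val j').2 by move=> /incr_perm [-> ->].
rewrite big1 => [|s /andP[_ ns]]; last first.
  by case: andP => // [[/eqP /inc [s1]]]; rewrite s1 eqxx in ns.
rewrite addr0 mulr1 big1 ?addr0 // => -[j s] /= nij.
rewrite big1 ?mulr0 // => s' _; case: andP => // [[/eqP /inc [-> e1]]].
rewrite comp_perm1 => /eqP /inc' [s1 e2]; case/eqP: nij.
rewrite s1; congr pair; apply: enum_val_inj; move: e1 e2.
by case: (enum_val j) => [a b]; case: (enum_val i) => [a' b'] /= -> ->.
Qed.

Definition hess (u : S) (i j : idx) : k := (u^`M(i)^`M(j))@_0%MM.

Lemma hess_sym u i j : hess u i j = hess u j i.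
Proof. by rewrite /hess mderiv_comm. Qed.

(** By Euler's identity the second derivatives at 0 give twice the quadratic part, which is a
    relation by homogeneity. *)
Lemma in_J_hess (u : S) : in_J u ->
  \sum_i \sum_j hess u i j *: (minor_of i * minor_of j) = 0.
Proof.
move=> /(in_J_pihomog 2) uJ.
have e : 2%:R *: pihomog mdeg 2 u = \sum_i \sum_j hess u i j *: ('X_i * 'X_j) :> S.
  apply/mpolyP=> M; rewrite mcoeffZ mcoeff_pihomog raddf_sum /=.
  have hE i j : hess u i j = u@_(U_(i) + U_(j))%MM *+ (U_(j)%MM i).+1.
    by rewrite /hess !mcoeff_deriv mnm0E mulr1n add0m addmC.
  transitivity (\sum_i if mdeg M == 2 then u@_M *+ M i else 0); last first.
    apply: eq_bigr => i _; rewrite raddf_sum /=.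
    under eq_bigr do rewrite mcoeffZ -mpolyXD mcoeffX hE.
    have [e|ne] := eqVneq (mdeg M) 2; last first.
      rewrite big1 // => j _; case: eqP => [eM|]; last by rewrite mulr0.
      by rewrite -eM mdegD !mdeg1 in ne.
    have [Mi|Mi] := posnP (M i).
      rewrite Mi mulr0n big1 // => j _; case: eqP => [eM|]; last by rewrite mulr0.
      by move: Mi; rewrite -eM mnmDE mnm1E eqxx.
    have le : (U_(i) <= M)%MM.
      by apply/mnm_lepP=> j; rewrite mnm1E; case: eqP => // <-.
    have /mdeg1P[j /eqP eMj] : mdeg (M - U_(i))%MM == 1%N.
      by move/eqP: e; rewrite -{1}(submK le) mdegD mdeg1 addn1 eqSS.
    have eM : (U_(i) + U_(j))%MM = M by rewrite -eMj addmC submK.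
    rewrite (bigD1 j) //= eM eqxx mulr1 big1 ?addr0 => [|j' nj].
      by rewrite -eM mnmDE [U_(i)%MM i]mnm1E eqxx.
    case: eqP => [eM'|]; last by rewrite mulr0.
    case/eqP: nj; have eU : U_(j')%MM = U_(j)%MM by rewrite -eMj -eM' addmC addmK.
    have := congr1 (fun N : 'X_{1..#|{: minor_idx t m n}|} => N j') eU.
    by rewrite !mnm1E eqxx; case: eqP.
  have [e|ne] := eqVneq (mdeg M) 2; last by rewrite mulr0 big1.
  by rewrite sumrMnr -mdegE e mulr_natl.
have := congr1 (@minor_map k t m n) e.
rewrite /minor_map linearZ /= -/(minor_map _) uJ scaler0 => /esym.
rewrite raddf_sum /= => h; rewrite -[RHS]h; apply: eq_bigr => i _.
rewrite raddf_sum /=; apply: eq_bigr => j _; rewrite linearZ rmorphM /=.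
by rewrite !comp_mpolyXU -!tnth_nth !tnth_mktuple.
Qed.

End Relations.

(** * Cubic forms attached to kernels *)

Section Blocks.
Variable t : nat.
Local Notation U := ('I_3 * 'I_t)%type.

Definition b0 : 'I_3 := @Ordinal 3 0 isT.
Definition b1 : 'I_3 := @Ordinal 3 1 isT.
Definition b2 : 'I_3 := @Ordinal 3 2 isT.

Lemma block_cases (c : 'I_3) : [\/ c = b0, c = b1 | c = b2].
Proof.
by case: c => [[|[|[|//]]] h];
  [apply: Or31 | apply: Or32 | apply: Or33]; apply/val_inj.
Qed.

Definition block n (c : 'I_3) (f : {ffun U -> 'I_n}) : {ffun 'I_t -> 'I_n} :=
  [ffun a => f (c, a)].

Definition join n (p0 p1 p2 : {ffun 'I_t -> 'I_n}) : {ffun U -> 'I_n} :=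
  [ffun x => if x.1 == b0 then p0 x.2 else if x.1 == b1 then p1 x.2 else p2 x.2].

Lemma join_block n (f : {ffun U -> 'I_n}) : join (block b0 f) (block b1 f) (block b2 f) = f.
Proof.
by apply/ffunP=> -[c a]; rewrite !ffunE /=; case: (block_cases c) => ->.
Qed.

Lemma block_join n (p0 p1 p2 : {ffun 'I_t -> 'I_n}) :
  [/\ block b0 (join p0 p1 p2) = p0, block b1 (join p0 p1 p2) = p1
    & block b2 (join p0 p1 p2) = p2].
Proof. by split; apply/ffunP=> a; rewrite !ffunE. Qed.

Lemma prod_blocks (A : comNzRingType) (F : U -> A) :
  \prod_x F x = \prod_a F (b0, a) * \prod_a F (b1, a) * \prod_a F (b2, a).
Proof.
rewrite (eq_bigr (fun x => F (x.1, x.2))) => [|[] //].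
rewrite -(pair_bigA _ (fun c a => F (c, a))) /= !big_ord_recl big_ord0 mulr1 mulrA.
by congr (_ * _ * _); apply: eq_bigr => a _; congr (F (_, _)); apply/val_inj.
Qed.

Lemma prod_low (A : comNzRingType) (F : U -> A) :
  \prod_(x in low t) F x = \prod_a F (b0, a) * \prod_a F (b1, a).
Proof.
rewrite big_mkcond prod_blocks /=.
rewrite [X in _ * X]big1 ?mulr1 => [|a _]; last by rewrite inE.
by congr (_ * _); apply: eq_bigr => a _; rewrite inE.
Qed.

Definition emb_fun (c : 'I_3) (s : 'S_t) (x : U) : U := if x.1 == c then (c, s x.2) else x.

Lemma emb_inj c s : injective (emb_fun c s).
Proof.
apply: (can_inj (g := emb_fun c s^-1%g)) => -[c' a]; rewrite /emb_fun /=.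
by case: (c' =P c) => [->|/eqP/negPf ne] /=; rewrite ?eqxx ?permK ?ne.
Qed.

Definition emb c s : {perm U} := perm (@emb_inj c s).

Lemma embE c s (x : U) : emb c s x = if x.1 == c then (c, s x.2) else x.
Proof. by rewrite permE. Qed.

Lemma emb_young c s : emb c s \in young (@blk t).
Proof. by apply/youngP=> x; rewrite embE; case: eqP => // <-. Qed.

Lemma embM c s s' : emb c (s * s')%g = (emb c s * emb c s')%g.
Proof.
apply/perm.permP=> x; rewrite permM !embE.
by case: eqP => [e|/eqP/negPf ne]; rewrite /= ?eqxx ?permM ?ne.
Qed.

Lemma odd_emb c s : odd_perm (emb c s) = odd_perm s.
Proof.
apply: (@odd_perm_morph _ _ (emb c) (pair c)) => [a a' []|s1 s2|x y] //.
  exact: embM.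
apply/perm.permP=> -[c' a]; rewrite embE /=; case: eqP => [->|ne].
  by case: tpermP => [->|->|n1 n2]; rewrite ?tpermL ?tpermR ?tpermD // xpair_eqE eqxx /= eq_sym;
    apply/eqP.
by rewrite tpermD // xpair_eqE; apply/negP=> /andP[/eqP e _]; case: ne.
Qed.

Lemma block_young n c (b : {perm U}) : b \in young (@blk t) ->
  exists s : 'S_t, forall f : {ffun U -> 'I_n},
    block c (comp_perm b f) = comp_perm s (block c f).
Proof.
move=> /youngP bY.
have bE a : b (c, a) = (c, (b (c, a)).2).
  by rewrite [LHS]surjective_pairing; congr (_, _); apply/val_inj/(bY (c, a)).
have inj : injective (fun a => (b (c, a)).2).
  move=> a a' e; have : b (c, a) = b (c, a') by rewrite bE e -bE.
  by move/perm_inj => [].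
by exists (perm inj) => f; apply/ffunP=> a; rewrite !ffunE permE -bE.
Qed.

Lemma comp_emb_join n (p0 p1 p2 : {ffun 'I_t -> 'I_n}) s :
  [/\ comp_perm (emb b0 s) (join p0 p1 p2) = join (comp_perm s p0) p1 p2,
      comp_perm (emb b1 s) (join p0 p1 p2) = join p0 (comp_perm s p1) p2
    & comp_perm (emb b2 s) (join p0 p1 p2) = join p0 p1 (comp_perm s p2)].
Proof.
by split; apply/ffunP=> -[c a]; rewrite !ffunE embE /=; case: (block_cases c) => -> /=; rewrite ?ffunE.
Qed.

Lemma comp_brot_join n (p0 p1 p2 : {ffun 'I_t -> 'I_n}) :
  comp_perm (brot_perm t) (join p0 p1 p2) = join p1 p2 p0.
Proof.
apply/ffunP=> -[c a]; rewrite !ffunE permE.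
have -> : brot (c, a) = (if c == b0 then b1 else if c == b1 then b2 else b0, a).
  by apply: pos_eq; rewrite ?brot1 ?brot2 //; case: (block_cases c) => ->.
by case: (block_cases c) => ->.
Qed.

Definition swap_fun (x : U) : U := (if x.1 == b0 then b1 else if x.1 == b1 then b0 else x.1, x.2).

Lemma swap_inj : injective swap_fun.
Proof.
apply: (can_inj (g := swap_fun)) => -[c a]; rewrite /swap_fun /=.
by case: (block_cases c) => ->.
Qed.

Definition swap : {perm U} := perm swap_inj.

Lemma comp_swap_join n (p0 p1 p2 : {ffun 'I_t -> 'I_n}) :
  comp_perm swap (join p0 p1 p2) = join p1 p0 p2.
Proof.
by apply/ffunP=> -[c a]; rewrite !ffunE permE /swap_fun /=; case: (block_cases c) => ->.
Qed.

Lemma blk_swap x y : (blk (swap x) == blk (swap y)) = (blk x == blk y).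
Proof.
case: x y => [c a] [c' a']; rewrite !permE /blk /=.
by case: (block_cases c) (block_cases c') => -> [] ->.
Qed.

Lemma swap_low : perm_on (low t) swap.
Proof.
apply/subsetP=> -[c a]; rewrite !inE permE /swap_fun /=.
by case: (block_cases c) => -> //; rewrite eqxx.
Qed.

Lemma splits_swap u : splits u swap.
Proof.
apply/forallP=> x; apply/implyP=> px; rewrite blk_swap /blk flip1 px.
by case/andP: px => h _; lia.
Qed.

Lemma sum_join (V : nmodType) m n
    (F : {ffun U -> 'I_m} -> {ffun U -> 'I_n} -> V) :
  \sum_f \sum_g F f g =
  \sum_(y : ({ffun 'I_t -> 'I_m} * {ffun 'I_t -> 'I_n}))
    \sum_(y' : ({ffun 'I_t -> 'I_m} * {ffun 'I_t -> 'I_n}))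
      \sum_(y'' : ({ffun 'I_t -> 'I_m} * {ffun 'I_t -> 'I_n}))
        F (join y.1 y'.1 y''.1) (join y.2 y'.2 y''.2).
Proof.
rewrite pair_bigA /= [RHS]pair_bigA [RHS]pair_bigA /=.
rewrite (reindex (fun z => (join z.1.1.1 z.1.2.1 z.2.1, join z.1.1.2 z.1.2.2 z.2.2))) //=.
exists (fun z => (((block b0 z.1, block b0 z.2), (block b1 z.1, block b1 z.2)),
                  (block b2 z.1, block b2 z.2))).
  move=> [[[p0 q0] [p1 q1]] [p2 q2]] _ /=.
  by have [-> -> ->] := block_join p0 p1 p2; have [-> -> ->] := block_join q0 q1 q2.
by move=> [f g] _ /=; rewrite !join_block.
Qed.

End Blocks.

Section Cubics.
Variables (k : fieldType) (t m n : nat).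
Hypotheses (char0 : [pchar k] =i pred0) (t_gt0 : (0 < t)%N).
Local Notation U := ('I_3 * 'I_t)%type.
Local Notation S := (polyS k t m n).
Local Notation R := (polyR k m n).
Local Notation X := (generic_mx k m n).
Implicit Types (f : {ffun U -> 'I_m}) (g : {ffun U -> 'I_n}).

Definition xprod f g : S :=
  xvar k (block b0 f) (block b0 g) * xvar k (block b1 f) (block b1 g) *
  xvar k (block b2 f) (block b2 g).

(** Summing over all sequences, not only increasing ones, turns any kernel on tensors into a cubic
    form without normalization. *)
Definition cubic (H : {ffun U -> 'I_m} -> {ffun U -> 'I_n} -> k) : S :=
  \sum_f \sum_g H f g *: xprod f g.

Lemma cubic_homog H : cubic H \is 3.-homog.
Proof.
rewrite rpred_sum // => f _; rewrite rpred_sum // => g _; rewrite rpredZ //.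
by apply: (@dhomogM _ _ _ 2 _ 1); rewrite ?xvar_homog //; apply: (@dhomogM _ _ _ 1 _ 1);
  rewrite ?xvar_homog.
Qed.

Lemma actS_xprod a b f g :
  actS a b (xprod f g) =
  \sum_(f' : {ffun U -> 'I_m}) \sum_(g' : {ffun U -> 'I_n}) ((\prod_x a (f' x) (f x)) * (\prod_x invmx b (g x) (g' x))) *: xprod f' g'.
Proof.
pose W c (y : {ffun 'I_t -> 'I_m} * {ffun 'I_t -> 'I_n}) :=
  ((\prod_x a (y.1 x) (block c f x)) * (\prod_x invmx b (block c g x) (y.2 x))) *:
  xvar k y.1 y.2.
have WE c : actS a b (xvar k (block c f) (block c g)) = \sum_y W c y.
  by rewrite (actS_xvar (two_neq0 char0)) pair_bigA.
rewrite sum_join; transitivity ((\sum_y W b0 y) * (\sum_y W b1 y) * (\sum_y W b2 y)).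
  by rewrite -!WE /actS !rmorphM.
rewrite big_distrlr /= mulr_suml; apply: eq_bigr => y _.
rewrite mulr_suml; apply: eq_bigr => y' _.
rewrite mulr_sumr; apply: eq_bigr => y'' _.
rewrite /W -!scalerAl -!scalerAr -!scalerAl !scalerA !prod_blocks /xprod.
have E (M : 'M[k]_m) c (f1 f2 : {ffun U -> 'I_m}) :
  \prod_x M (f1 (c, x)) (f2 (c, x)) = \prod_x M (block c f1 x) (block c f2 x).
  by apply: eq_bigr => x _; rewrite !ffunE.
have E' (M : 'M[k]_n) c (g1 g2 : {ffun U -> 'I_n}) :
  \prod_x M (g1 (c, x)) (g2 (c, x)) = \prod_x M (block c g1 x) (block c g2 x).
  by apply: eq_bigr => x _; rewrite !ffunE.
rewrite !E !E'; have [-> -> ->] := block_join y.1 y'.1 y''.1.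
have [-> -> ->] := block_join y.2 y'.2 y''.2.
by congr (_ *: _); ring.
Qed.

Lemma actS_cubic a b H :
  actS a b (cubic H) = cubic (fun f g => \sum_(f' : {ffun U -> 'I_m}) \sum_(g' : {ffun U -> 'I_n})
    (\prod_x a (f x) (f' x)) * (\prod_x invmx b (g' x) (g x)) * H f' g').
Proof.
rewrite /cubic /actS raddf_sum /=.
under eq_bigr => f _.
  rewrite raddf_sum /=; under eq_bigr => g _.
    rewrite linearZ /= -/(actS a b _) actS_xprod scaler_sumr; over.
  over.
rewrite pair_bigA /= exchange_big /=; apply: eq_bigr => f _.
under eq_bigr do rewrite scaler_sumr.
rewrite exchange_big /=; apply: eq_bigr => g _.
rewrite pair_bigA /= scaler_suml; apply: eq_bigr => y _.
by rewrite scalerA mulrC.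
Qed.

Lemma minor_map_xprod f g :
  minor_map (xprod f g) =
  \sum_(s0 : 'S_t) \sum_(s1 : 'S_t) \sum_(s2 : 'S_t)
    ((-1) ^+ s0 * (-1) ^+ s1 * (-1) ^+ s2) *:
    \prod_x X (f x) (g ((emb b0 s0 * emb b1 s1 * emb b2 s2)%g x)).
Proof.
rewrite /minor_map !rmorphM /= -!/(minor_map _) !(minor_map_xvar (two_neq0 char0)) !sdet_genericE.
rewrite big_distrlr /= mulr_suml; apply: eq_bigr => s0 _.
rewrite mulr_suml; apply: eq_bigr => s1 _.
rewrite mulr_sumr; apply: eq_bigr => s2 _.
have sc (x y z : k) (A B C : R) : x *: A * (y *: B) * (z *: C) = (x * y * z) *: (A * B * C).
  rewrite -!mul_mpolyC !mpolyCM; move: (x%:MP) (y%:MP) (z%:MP) => x' y' z'; ring.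
rewrite sc prod_blocks; congr (_ *: (_ * _ * _)).
- by apply: eq_big => a; rewrite ?inE // => _; rewrite !ffunE !permM !embE.
- by apply: eq_big => a; rewrite ?inE // => _; rewrite !ffunE !permM !embE.
- by apply: eq_big => a; rewrite ?inE // => _; rewrite !ffunE !permM !embE.
Qed.

(* For every matching [s] of the row positions with the column positions, the
   monomials cancel in pairs. *)
Lemma cubic_in_J (H : {ffun U -> 'I_m} -> {ffun U -> 'I_n} -> k) :
  (forall s : {perm U}, exists x y,
     (forall f g, H (comp_perm (tperm x y) f) g = H f g) /\
     (forall f g, H f (comp_perm (tperm (s x) (s y)) g) = - H f g)) ->
  in_J (cubic H).
Proof.
move=> sgnH; rewrite /in_J /cubic.
have inner (s : {perm U}) : \sum_f \sum_g H f g *: \prod_x X (f x) (g (s x)) = 0.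
  have [x [y [Hf Hg]]] := sgnH s; set Z := \sum_f _.
  (* Exchanging [x] and [y] in [f] and their images in [g] only reorders the factors of the
     monomial, whereas [H] changes sign. *)
  have ZN : Z = - Z.
    rewrite {1}/Z (reindex_inj (@comp_perm_inj _ _ (tperm x y))) -sumrN /=.
    apply: eq_bigr => f _.
    rewrite (reindex_inj (@comp_perm_inj _ _ (tperm (s x) (s y)))) -sumrN /=.
    apply: eq_bigr => g _; rewrite Hf Hg scaleNr; congr (- (_ *: _)).
    rewrite [RHS](reindex_inj (@perm_inj _ (tperm x y))) /=; apply: eq_bigr => z _.
    rewrite !ffunE; congr (X _ (g _)).
    by rewrite -!permM -tpermJ conjgE !mulgA mulgV mul1g.
  have : 2%:R *: Z = 0 by rewrite scaler_nat mulr2n {1}ZN addNr.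
  by move/eqP; rewrite scaler_eq0 (negPf (two_neq0 char0)) => /eqP.
have -> : minor_map (\sum_f \sum_g H f g *: xprod f g) =
  \sum_(s0 : 'S_t) \sum_(s1 : 'S_t) \sum_(s2 : 'S_t)
    ((-1) ^+ s0 * (-1) ^+ s1 * (-1) ^+ s2) *:
    \sum_f \sum_g H f g *:
      \prod_x X (f x) (g ((emb b0 s0 * emb b1 s1 * emb b2 s2)%g x)).
  have swp (I J : finType) (F : I -> J -> 'S_t -> R) :
    \sum_i \sum_j \sum_s F i j s = \sum_s \sum_i \sum_j F i j s.
    by rewrite [RHS]exchange_big; apply: eq_bigr => i _; rewrite exchange_big.
  rewrite /minor_map raddf_sum /=.
  under eq_bigr => f _.
    rewrite raddf_sum /=; under eq_bigr => g _ do
      rewrite linearZ /= -/(minor_map _) minor_map_xprod scaler_sumr.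
    over.
  rewrite swp; apply: eq_bigr => s0 _.
  under eq_bigr => f _ do under eq_bigr => g _ do rewrite scaler_sumr.
  rewrite swp; apply: eq_bigr => s1 _.
  under eq_bigr => f _ do under eq_bigr => g _ do rewrite scaler_sumr.
  rewrite swp; apply: eq_bigr => s2 _.
  rewrite scaler_sumr; apply: eq_bigr => f _; rewrite scaler_sumr; apply: eq_bigr => g _.
  by rewrite !scalerA mulrC.
by rewrite big1 // => s0 _; rewrite big1 // => s1 _; rewrite big1 // => s2 _;
  rewrite inner scaler0.
Qed.

End Cubics.

(** * A functional vanishing on decomposable cubic relations *)

Lemma scaleE (k : fieldType) (c : k) (x : k^o) : c *: x = c * x.
Proof. by []. Qed.

Lemma ten_scaleE (k : fieldType) (B : finType) n (c : k) (z : ten k B n) f :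
  (c *: z) f = c * z f.
Proof. by rewrite ffunE. Qed.

Lemma scale_signs (k : fieldType) l (e0 e1 e2 e3 : bool) (P Q : {mpoly k[l]}) :
  ((-1) ^+ e0 * (-1) ^+ e1 * ((-1) ^+ e2 * (-1) ^+ e3)) *: (P * Q) =
  (-1) ^+ e0 * ((-1) ^+ e1 * P) * ((-1) ^+ e2 * ((-1) ^+ e3 * Q)).
Proof.
have E (e : bool) : (-1) ^+ e = ((-1) ^+ e : k)%:MP_[l].
  by case: e; rewrite ?expr1 ?expr0 ?mpolyCN ?mpolyC1.
rewrite -mul_mpolyC !mpolyCM -!E; move: ((-1) ^+ e0) ((-1) ^+ e1) ((-1) ^+ e2) ((-1) ^+ e3).
by move=> *; ring.
Qed.

Lemma balt_emb (k : fieldType) t n (a : ten k ('I_3 * 'I_t)%type n) c (s : 'S_t) f :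
  balt a (comp_perm (emb c s) f) = (-1) ^+ s * balt a f.
Proof.
have := congr1 (fun z : ten k ('I_3 * 'I_t)%type n => z f)
  (pl_young_op true a (emb_young c s)).
by rewrite !ffunE /= odd_emb.
Qed.

Section Detection.
Variables (k : fieldType) (t u m n : nat).
Hypotheses (char0 : [pchar k] =i pred0) (u_gt0 : (0 < u)%N) (le_2u_t : (2 * u <= t)%N).
Local Notation U := ('I_3 * 'I_t)%type.
Local Notation S := (polyS k t m n).
Local Notation R := (polyR k m n).
Local Notation X := (generic_mx k m n).
Local Notation idx := 'I_(#|{: minor_idx t m n}|).
Variables (T : ten k U m) (T' : ten k U n).
Local Notation a := (balt (gsym u T)).
Local Notation b := (balt (lsym u T')).
Local Notation rows := (@minor_rows t m n).
Local Notation cols := (@minor_cols t m n).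

Lemma t_gt0 : (0 < t)%N. Proof. lia. Qed.

Definition kernel (i0 i1 i2 : idx) : k :=
  a (join (rows i0) (rows i1) (rows i2)) * b (join (cols i0) (cols i1) (cols i2)).

Lemma kernel_rot f0 f1 f2 g0 g1 g2 :
  a (join f1 f2 f0) * b (join g1 g2 g0) = a (join f0 f1 f2) * b (join g0 g1 g2).
Proof.
rewrite -(comp_brot_join f0 f1 f2) -(comp_brot_join g0 g1 g2); congr (_ * _).
  by rewrite -[in RHS](pl_rot_gsym u_gt0 le_2u_t) !ffunE.
by rewrite -[in RHS](pl_rot_lsym u_gt0 le_2u_t) !ffunE.
Qed.

(** Both tableaux give the same sign, which squares to 1. Together with [kernel_rot] this yields
    invariance under all permutations of the blocks. *)
Lemma kernel_swap f0 f1 f2 g0 g1 g2 :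
  a (join f1 f0 f2) * b (join g1 g0 g2) = a (join f0 f1 f2) * b (join g0 g1 g2).
Proof.
rewrite -(comp_swap_join f0 f1 f2) -(comp_swap_join g0 g1 g2).
have [e [ea eb]] := balt_pl_splits u_gt0 le_2u_t (swap_low t) (splits_swap t u).
have E (l : nat) (z : ten k U l) f : balt z (comp_perm (swap t) f) = balt (pl (swap t) z) f.
  by rewrite /balt -(pl_young_opC _ _ (@blk_swap t)) ffunE.
rewrite !E ea eb !ffunE.
by rewrite !scaleE mulrACA -signr_addb addbb mul1r.
Qed.

Lemma sum_splits f g :
  \sum_(s : {perm U} | perm_on (low t) s)
     balt (pl s (gsym u T)) f * balt (pl s (lsym u T')) g =
  #|[set s : {perm U} | perm_on (low t) s & splits u s]|%:R * (a f * b g).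
Proof.
rewrite -sum1_card natr_sum mulr_suml [LHS](bigID (splits u)) /= [X in _ + X]big1 ?addr0.
  apply: eq_big => s; rewrite ?inE // => /andP[s_on s_sp].
  have [e [ea eb]] := balt_pl_splits u_gt0 le_2u_t s_on s_sp.
  by rewrite ea eb !ffunE !scaleE mulrACA -signr_addb addbb mul1r.
move=> s /andP[_ nsp]; have [ea _] := balt_pl_nsplit u_gt0 le_2u_t nsp.
by rewrite ea ?(two_neq0 char0) // ffunE mul0r.
Qed.

Lemma splits_card_neq0 : #|[set s : {perm U} | perm_on (low t) s & splits u s]|%:R != 0 :> k.
Proof.
rewrite ((pcharf0P k).1 char0) -lt0n; apply/card_gt0P; exists 1%g.
by rewrite inE perm_on1 splits1.
Qed.

Lemma block_off (l : nat) (p0 p1 p0' p1' p2 : {ffun 'I_t -> 'I_l}) (s : {perm U}) :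
  s \in young (@blk t) ->
  {in ~: low t, comp_perm s (join p0 p1 p2) =1 comp_perm s (join p0' p1' p2)}.
Proof.
move=> /youngP sY x; rewrite !inE !ffunE => nx.
have e c : (c < 2)%N -> ((s x).1 == c :> nat) = false.
  by move=> c2; rewrite [(s x).1 : nat]sY; apply/eqP=> xc; move: nx; rewrite -[nat_of_ord x.1]/(blk x) xc c2.
by rewrite -!val_eqE /= !e.
Qed.

(* Relations of degree 2 among the minors are killed by the kernel: it is, up
   to a nonzero factor, an average over the permutations of the first two
   blocks. *)
Lemma kernel_hess (w : S) i2 : in_J w ->
  \sum_(i0 : idx) \sum_(i1 : idx) hess w i0 i1 * kernel i0 i1 i2 = 0.
Proof.
move=> wJ; have rel := in_J_hess t_gt0 wJ.
pose f (y : idx * idx) := join (rows y.1) (rows y.2) (rows i2).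
pose g (y : idx * idx) := join (cols y.1) (cols y.2) (cols i2).
pose sg (z : 'S_t * 'S_t) : {perm U} := (emb b0 z.1 * emb b1 z.2)%g.
pose c (y : (idx * idx) * ('S_t * 'S_t)) : k :=
  hess w y.1.1 y.1.2 * ((-1) ^+ y.2.1 * (-1) ^+ y.2.2).
pose fb (p : {perm U}) (y : (idx * idx) * ('S_t * 'S_t)) := comp_perm p (f y.1).
pose gb (p : {perm U}) (y : (idx * idx) * ('S_t * 'S_t)) :=
  comp_perm (sg y.2) (comp_perm p (g y.1)).
have sgY z : sg z \in young (@blk t) by rewrite youngM ?emb_young.
(* Permutations preserving blocks change the two minors by signs only, so the quadratic relation
   persists; the functional of [mon_relation] is built from the tensors before [balt]. *)
have relb (p q : {perm U}) : p \in young (@blk t) -> q \in young (@blk t) ->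
  \sum_y c y * \sum_(s : {perm U} | perm_on (low t) s)
     (gsym u T (comp_perm s (fb p y)) * lsym u T' (comp_perm s (gb q y))) = 0.
  move=> pY qY.
  apply: (@mon_relation k m n _ (low t) _ c (fb p) (gb q)
     (fun f' g' => gsym u T f' * lsym u T' g')).
  - by move=> y y'; apply: block_off.
  - move=> y y' x nx; rewrite /gb !comp_permM.
    have off z : (sg z * q)%g x = q x.
      rewrite permM; congr (q _); rewrite permM !embE; move: nx; rewrite !inE.
      by case: (block_cases x.1) => ex; rewrite ex //= ex.
    rewrite !ffunE !off; have := @block_off _ (cols y.1.1) (cols y.1.2)
      (cols y'.1.1) (cols y'.1.2) (cols i2) q qY x nx.
    by rewrite !ffunE.
  rewrite -(pair_bigA _ (fun y z => c (y, z) *: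
    \prod_(x in low t) X (fb p (y, z) x) (gb q (y, z) x))) /=.
  have [p0 p0E] := @block_young t m b0 p pY; have [p1 p1E] := @block_young t m b1 p pY.
  have [q0 q0E] := @block_young t n b0 q qY; have [q1 q1E] := @block_young t n b1 q qY.
  transitivity (\sum_(y : idx * idx) ((-1) ^+ p0 * (-1) ^+ q0 * ((-1) ^+ p1 * (-1) ^+ q1)) *:
     (hess w y.1 y.2 *: (minor_of k y.1 * minor_of k y.2))); last first.
    by rewrite -scaler_sumr -(pair_bigA _ (fun i j => hess w i j *: (minor_of k i * minor_of k j)))
      rel scaler0.
  apply: eq_bigr => y _; rewrite -(pair_bigA _ (fun s0 s1 => c (y, (s0, s1)) *:
    \prod_(x in low t) X (fb p (y, (s0, s1)) x) (gb q (y, (s0, s1)) x))) /=.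
  rewrite scalerA mulrC -scalerA.
  have -> : ((-1) ^+ p0 * (-1) ^+ q0 * ((-1) ^+ p1 * (-1) ^+ q1)) *: (minor_of k y.1 * minor_of k y.2)
     = sdet X (block b0 (comp_perm p (f y))) (block b0 (comp_perm q (g y))) *
       sdet X (block b1 (comp_perm p (f y))) (block b1 (comp_perm q (g y))).
    rewrite p0E p1E q0E q1E !sdet_perml !sdet_permr /f /g.
    have [-> -> _] := block_join (rows y.1) (rows y.2) (rows i2).
    have [-> -> _] := block_join (cols y.1) (cols y.2) (cols i2).
    exact: scale_signs.
  rewrite !sdet_genericE big_distrlr /= scaler_sumr; apply: eq_bigr => s0 _.
  rewrite scaler_sumr; apply: eq_bigr => s1 _.
  rewrite -scalerAl -scalerAr !scalerA /c /= prod_low -mulrA; congr (_ *: (_ * _)).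
  - apply: eq_big => x; rewrite ?inE // => _; rewrite /fb /gb /= !ffunE /sg /=.
    by rewrite !permM !embE.
  - apply: eq_big => x; rewrite ?inE // => _; rewrite /fb /gb /= !ffunE /sg /=.
    by rewrite !permM !embE.
have baltE l (z : ten k U l) (s r : {perm U}) h :
    \sum_(p in young (@blk t)) (-1) ^+ p * z (comp_perm s (comp_perm r (comp_perm p h))) =
    balt (pl r (pl s z)) h.
  by rewrite /balt /young_op sum_ffunE; apply: eq_bigr => p _; rewrite !ffunE.
pose N : k := #|[set s : {perm U} | perm_on (low t) s & splits u s]|%:R.
(* Antisymmetrizing over [p] and [q] restores [balt]. All terms of the expanded determinants
   contribute equally, so their number is divided out along with [N]. *)
have total : \sum_(y : (idx * idx) * ('S_t * 'S_t))
    hess w y.1.1 y.1.2 * (N * (a (f y.1) * b (g y.1))) = 0; last first.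
  move: total; rewrite -(pair_bigA _ (fun (y : idx * idx) (_ : 'S_t * 'S_t) =>
     hess w y.1 y.2 * (N * (a (f y) * b (g y))))) /=.
  under eq_bigr do rewrite sumr_const.
  rewrite sumrMnl => /eqP; rewrite -mulr_natl mulf_eq0 ((pcharf0P k).1 char0).
  rewrite -[_ == 0%N]negbK -lt0n; have -> : (0 < #|{: 'S_t * 'S_t}|)%N.
    by apply/card_gt0P; exists (1%g, 1%g).
  move=> /= /eqP e; have : N * \sum_(y : idx * idx) hess w y.1 y.2 * (a (f y) * b (g y)) = 0.
    by rewrite mulr_sumr -[RHS]e; apply: eq_bigr => y _; rewrite mulrCA.
  move/eqP; rewrite mulf_eq0 (negPf splits_card_neq0) => /eqP.
  by rewrite -(pair_bigA _ (fun i0 i1 => hess w i0 i1 * kernel i0 i1 i2)).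
have {}relb : \sum_(p in young (@blk t)) \sum_(q in young (@blk t))
   (-1) ^+ p * (-1) ^+ q * \sum_y c y * \sum_(s : {perm U} | perm_on (low t) s)
     (gsym u T (comp_perm s (fb p y)) * lsym u T' (comp_perm s (gb q y))) = 0.
  by apply: big1 => p pY; apply: big1 => q qY; rewrite relb // mulr0.
rewrite -[RHS]relb.
transitivity (\sum_y c y * \sum_(s : {perm U} | perm_on (low t) s)
  \sum_(p in young (@blk t)) \sum_(q in young (@blk t))
   (-1) ^+ p * (-1) ^+ q *
   (gsym u T (comp_perm s (fb p y)) * lsym u T' (comp_perm s (gb q y)))); last first.
  under eq_bigr do rewrite mulr_sumr.
  under [RHS]eq_bigr => p _ do under eq_bigr => q _ do rewrite mulr_sumr.
  under [RHS]eq_bigr => p _ do rewrite exchange_big.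
  rewrite [RHS]exchange_big; apply: eq_bigr => y _ /=.
  under [RHS]eq_bigr => p _ do under eq_bigr => q _ do rewrite mulrCA mulr_sumr mulr_sumr.
  under [RHS]eq_bigr => p _ do rewrite exchange_big.
  rewrite [RHS]exchange_big; apply: eq_bigr => s _ /=.
  by rewrite mulr_sumr; apply: eq_bigr => p _; rewrite mulr_sumr.
apply: eq_bigr => y _; rewrite -sum_splits.
rewrite /c -[RHS]mulrA; congr (_ * _); rewrite mulr_sumr; apply: eq_bigr => s _.
transitivity ((-1) ^+ y.2.1 * (-1) ^+ y.2.2 * (balt (pl s (gsym u T)) (f y.1) *
   balt (pl (sg y.2) (pl s (lsym u T'))) (g y.1))).
  have -> : balt (pl (sg y.2) (pl s (lsym u T'))) = (-1) ^+ sg y.2 *: balt (pl s (lsym u T')).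
    exact: young_op_pl.
  rewrite ten_scaleE odd_permM !odd_emb signr_addb.
  set x : k := (-1) ^+ y.2.1 * (-1) ^+ y.2.2.
  have xx : x * x = 1 by rewrite /x mulrACA -!signr_addb !addbb.
  by rewrite [RHS]mulrCA [x * (x * _)]mulrA xx mul1r.
rewrite -[gsym u T]pl1 -[pl s (pl _ _)]pl1 -!baltE.
rewrite pl1; congr (_ * _); rewrite mulr_suml; apply: eq_bigr => p _.
by rewrite mulr_sumr; apply: eq_bigr => q _; rewrite comp_perm1 mulrACA.
Qed.

Definition third (F : S) (i0 i1 i2 : idx) : k := (F^`M(i0)^`M(i1)^`M(i2))@_0%MM.

(** Third derivatives at 0 give the symmetric trilinear form of the cubic part, which avoids any
    normal form for cubic monomials. *)
Definition detect (F : S) : k :=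
  \sum_i0 \sum_i1 \sum_i2 kernel i0 i1 i2 * third F i0 i1 i2.

Fact detect_is_additive : additive detect.
Proof.
move=> F G; rewrite /detect -sumrB; apply: eq_bigr => i0 _.
rewrite -sumrB; apply: eq_bigr => i1 _; rewrite -sumrB; apply: eq_bigr => i2 _.
by rewrite /third !mderivB mcoeffB mulrBr.
Qed.
HB.instance Definition _ := GRing.isAdditive.Build S k detect detect_is_additive.

Lemma detectZ c F : detect (c *: F) = c * detect F.
Proof.
rewrite /detect mulr_sumr; apply: eq_bigr => i0 _.
rewrite mulr_sumr; apply: eq_bigr => i1 _; rewrite mulr_sumr; apply: eq_bigr => i2 _.
by rewrite /third !mderivZ mcoeffZ mulrCA.
Qed.

Lemma kernel_cyc i0 i1 i2 : kernel i1 i2 i0 = kernel i0 i1 i2.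
Proof. exact: kernel_rot. Qed.

Lemma deriv1_coeff (w : S) i : (w^`M(i))@_0%MM = w@_U_(i)%MM.
Proof. by rewrite mcoeff_deriv mnm0E mulr1n add0m. Qed.

(** Since [v] has no constant part and [w] neither a constant nor a linear one, Leibniz leaves one
    derivative on [v] and two on [w]. Cyclic invariance moves the index of [v] last, where
    [kernel_hess] applies. *)
Lemma detect_mul (v w : S) : v@_0%MM = 0 -> in_J w -> detect (v * w) = 0.
Proof.
move=> v0 wJ; have w0 := in_J_coeff0 t_gt0 wJ.
have w1 i : (w^`M(i))@_0%MM = 0 by rewrite deriv1_coeff (in_J_coeff1 t_gt0).
have third_mul i0 i1 i2 : third (v * w) i0 i1 i2 =
    (v^`M(i0))@_0%MM * hess w i1 i2 + (v^`M(i1))@_0%MM * hess w i0 i2 +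
    (v^`M(i2))@_0%MM * hess w i0 i1.
  rewrite /third /hess !(mderivM, mderivD) !mcoeffD !rmorphM /= v0 w0 !w1.
  rewrite !(mulr0, mul0r, addr0, add0r).
  by rewrite addrA.
rewrite /detect.
transitivity (\sum_i0 \sum_i1 \sum_i2 kernel i0 i1 i2 * ((v^`M(i0))@_0%MM * hess w i1 i2) +
  \sum_i1 \sum_i2 \sum_i0 kernel i0 i1 i2 * ((v^`M(i1))@_0%MM * hess w i0 i2) +
  \sum_i2 \sum_i0 \sum_i1 kernel i0 i1 i2 * ((v^`M(i2))@_0%MM * hess w i0 i1)).
  have x1 (F : idx -> idx -> idx -> k) :
      \sum_i1 \sum_i2 \sum_i0 F i0 i1 i2 = \sum_i0 \sum_i1 \sum_i2 F i0 i1 i2.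
    rewrite [RHS]exchange_big; apply: eq_bigr => i1 _; exact: exchange_big.
  have x2 (F : idx -> idx -> idx -> k) :
      \sum_i2 \sum_i0 \sum_i1 F i0 i1 i2 = \sum_i0 \sum_i1 \sum_i2 F i0 i1 i2.
    by rewrite exchange_big; apply: eq_bigr => i0 _; rewrite exchange_big.
  rewrite (x1 (fun i0 i1 i2 => kernel i0 i1 i2 * ((v^`M(i1))@_0%MM * hess w i0 i2))).
  rewrite (x2 (fun i0 i1 i2 => kernel i0 i1 i2 * ((v^`M(i2))@_0%MM * hess w i0 i1))).
  rewrite -!big_split /=; apply: eq_bigr => i0 _; rewrite -!big_split /=.
  apply: eq_bigr => i1 _; rewrite -!big_split /=; apply: eq_bigr => i2 _.
  by rewrite third_mul !mulrDr.
have vanish (F : idx -> idx -> idx -> k) (d : idx -> k) :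
    (forall i i' i'', F i i' i'' = kernel i' i'' i * (d i * hess w i' i'')) ->
    \sum_i \sum_i' \sum_i'' F i i' i'' = 0.
  move=> FE; rewrite big1 // => i _; rewrite -[RHS](mulr0 (d i)) -[X in _ = _ * X](kernel_hess i wJ) mulr_sumr.
  apply: eq_bigr => i' _; rewrite mulr_sumr; apply: eq_bigr => i'' _.
  by rewrite FE mulrCA [_ * hess _ _ _]mulrC.
rewrite (vanish (fun i0 i1 i2 => kernel i0 i1 i2 * ((v^`M(i0))@_0%MM * hess w i1 i2))
  (fun i => (v^`M(i))@_0%MM)); last by move=> i0 i1 i2; rewrite -[in LHS]kernel_cyc.
rewrite (vanish (fun i1 i2 i0 => kernel i0 i1 i2 * ((v^`M(i1))@_0%MM * hess w i0 i2))
  (fun i => (v^`M(i))@_0%MM)); 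
  last by move=> i1 i2 i0; rewrite hess_sym [in LHS]kernel_cyc.
rewrite (vanish (fun i2 i0 i1 => kernel i0 i1 i2 * ((v^`M(i2))@_0%MM * hess w i0 i1))
  (fun i => (v^`M(i))@_0%MM)) //; last by rewrite !addr0.
Qed.

Lemma detect_mJ F : in_mJ F -> detect F = 0.
Proof.
case=> s [sJ ->]; rewrite raddf_sum /= big_seq big1 // => v vs.
by have [v0 vJ] := sJ v vs; apply: detect_mul.
Qed.

Definition xcoef (p : {ffun 'I_t -> 'I_m}) (q : {ffun 'I_t -> 'I_n}) (i : idx) : k :=
  sdet 1%:M (rows i) p * sdet 1%:M (cols i) q.

Lemma xvar_deriv p q i : (xvar k p q)^`M(i) = (xcoef p q i)%:MP.
Proof.
have dX I J : (minor_var k I J)^`M(i) = ((I, J) == enum_val i)%:R.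
  rewrite /minor_var mderivX mnm1E -(inj_eq enum_val_inj) enum_rankK.
  by case: eqP => [e|_]; rewrite ?scale0r // e enum_valK -{1}[U_(i)%MM]add0m addmK scale1r mpolyX0.
transitivity (\sum_(x : minor_idx t m n) (sdet 1%:M (val x.1) p * sdet 1%:M (val x.2) q) *:
    (x == enum_val i)%:R : S).
  rewrite /xvar raddf_sum -(pair_bigA _ (fun I J => (sdet 1%:M (val I) p * sdet 1%:M (val J) q) *:
    ((I, J) == enum_val i)%:R)) /=.
  apply: eq_bigr => I _; rewrite raddf_sum; apply: eq_bigr => J _ /=.
  by rewrite mderivZ dX.
rewrite (bigD1 (enum_val i)) //= eqxx -mul_mpolyC mulr1 big1 ?addr0 // => x /negPf ->.
by rewrite scaler0.
Qed.

Lemma sum_xcoef (F : {ffun 'I_t -> 'I_m} -> k) (G : {ffun 'I_t -> 'I_n} -> k) p q :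
  (forall (s : 'S_t) p, F (comp_perm s p) = (-1) ^+ s * F p) ->
  (forall (s : 'S_t) q, G (comp_perm s q) = (-1) ^+ s * G q) ->
  \sum_i xcoef p q i * (F (rows i) * G (cols i)) = F p * G q.
Proof.
move=> Fa Ga; rewrite (reindex (@enum_rank {: minor_idx t m n})) /=; last first.
  exact/onW_bij/enum_rank_bij.
rewrite -(sum_incr_alt (V := k^o) p (two_neq0 char0) Fa) -(sum_incr_alt (V := k^o) q (two_neq0 char0) Ga).
rewrite big_distrlr pair_bigA /=; apply: eq_bigr => -[I J] _.
by rewrite /xcoef /minor_rows /minor_cols enum_rankK /= !scaleE mulrACA.
Qed.

Lemma third_mul3 (l0 l1 l2 : S) (d0 d1 d2 : idx -> k) i0 i1 i2 :
  (forall i, l0^`M(i) = (d0 i)%:MP) -> (forall i, l1^`M(i) = (d1 i)%:MP) ->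
  (forall i, l2^`M(i) = (d2 i)%:MP) ->
  third (l0 * l1 * l2) i0 i1 i2 =
  d0 i0 * d1 i1 * d2 i2 + d0 i0 * d2 i1 * d1 i2 + d1 i0 * d0 i1 * d2 i2 +
  d1 i0 * d2 i1 * d0 i2 + d2 i0 * d0 i1 * d1 i2 + d2 i0 * d1 i1 * d0 i2.
Proof.
move=> h0 h1 h2; rewrite /third !(mderivM, mderivD, h0, h1, h2, mderivC).
rewrite !mcoeffD !rmorphM /= !mcoeffD !rmorphM /= !mcoeff0.
have c0 c : (c%:MP_[#|{: minor_idx t m n}|])@_0%MM = c :> k by rewrite mcoeffC eqxx mulr1.
rewrite !c0.
by move: (d0 i0) (d0 i1) (d0 i2) (d1 i0) (d1 i1) (d1 i2) (d2 i0) (d2 i1) (d2 i2) => *; ring.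
Qed.

Lemma balt_join0 l (z : ten k U l) p1 p2 (s : 'S_t) p :
  balt z (join (comp_perm s p) p1 p2) = (-1) ^+ s * balt z (join p p1 p2).
Proof. by have [<- _ _] := comp_emb_join p p1 p2 s; apply: balt_emb. Qed.

Lemma balt_join1 l (z : ten k U l) p0 p2 (s : 'S_t) p :
  balt z (join p0 (comp_perm s p) p2) = (-1) ^+ s * balt z (join p0 p p2).
Proof. by have [_ <- _] := comp_emb_join p0 p p2 s; apply: balt_emb. Qed.

Lemma balt_join2 l (z : ten k U l) p0 p1 (s : 'S_t) p :
  balt z (join p0 p1 (comp_perm s p)) = (-1) ^+ s * balt z (join p0 p1 p).
Proof. by have [_ _ <-] := comp_emb_join p0 p1 p s; apply: balt_emb. Qed.

Lemma sum_kernel p0 p1 p2 q0 q1 q2 :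
  \sum_i0 \sum_i1 \sum_i2
    kernel i0 i1 i2 * (xcoef p0 q0 i0 * xcoef p1 q1 i1 * xcoef p2 q2 i2) =
  a (join p0 p1 p2) * b (join q0 q1 q2).
Proof.
rewrite -(sum_xcoef p0 q0 (balt_join0 (gsym u T) p1 p2) (balt_join0 (lsym u T') q1 q2)).
apply: eq_bigr => i0 _.
rewrite -(sum_xcoef p1 q1 (balt_join1 (gsym u T) (rows i0) p2)
  (balt_join1 (lsym u T') (cols i0) q2)).
rewrite mulr_sumr; apply: eq_bigr => i1 _.
rewrite -(sum_xcoef p2 q2 (balt_join2 (gsym u T) (rows i0) (rows i1))
  (balt_join2 (lsym u T') (cols i0) (cols i1))).
rewrite !mulr_sumr; apply: eq_bigr => i2 _; rewrite -/(kernel i0 i1 i2).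
move: (kernel i0 i1 i2) (xcoef p0 q0 i0) (xcoef p1 q1 i1) (xcoef p2 q2 i2) => x y z v.
by ring.
Qed.

(** The three derivatives can hit the three factors in 6 orders, which agree by the symmetry of the
    kernel. *)
Lemma detect_xprod f g : detect (xprod k f g) = 6%:R * (a f * b g).
Proof.
rewrite -{2}[f]join_block -{2}[g]join_block /xprod.
move: (block b0 f) (block b1 f) (block b2 f) (block b0 g) (block b1 g) (block b2 g).
move=> p0 p1 p2 q0 q1 q2.
transitivity (\sum_i0 \sum_i1 \sum_i2
    kernel i0 i1 i2 * (xcoef p0 q0 i0 * xcoef p1 q1 i1 * xcoef p2 q2 i2) +
  \sum_i0 \sum_i1 \sum_i2
    kernel i0 i1 i2 * (xcoef p0 q0 i0 * xcoef p2 q2 i1 * xcoef p1 q1 i2) +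
  \sum_i0 \sum_i1 \sum_i2
    kernel i0 i1 i2 * (xcoef p1 q1 i0 * xcoef p0 q0 i1 * xcoef p2 q2 i2) +
  \sum_i0 \sum_i1 \sum_i2
    kernel i0 i1 i2 * (xcoef p1 q1 i0 * xcoef p2 q2 i1 * xcoef p0 q0 i2) +
  \sum_i0 \sum_i1 \sum_i2
    kernel i0 i1 i2 * (xcoef p2 q2 i0 * xcoef p0 q0 i1 * xcoef p1 q1 i2) +
  \sum_i0 \sum_i1 \sum_i2
    kernel i0 i1 i2 * (xcoef p2 q2 i0 * xcoef p1 q1 i1 * xcoef p0 q0 i2)).
  rewrite /detect -!big_split; apply: eq_bigr => i0 _ /=.
  rewrite -!big_split; apply: eq_bigr => i1 _ /=.
  rewrite -!big_split; apply: eq_bigr => i2 _ /=.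
  by rewrite -!mulrDr; congr (_ * _); apply: third_mul3 => i; apply: xvar_deriv.
rewrite !sum_kernel.
rewrite (kernel_rot p1 p2 p0) (kernel_rot p0 p1 p2).
rewrite (kernel_rot p0 p2 p1) (kernel_rot p1 p0 p2) (kernel_swap p0 p1 p2).
by rewrite -mulrDl; ring.
Qed.

Lemma detect_cubic (H : {ffun U -> 'I_m} -> {ffun U -> 'I_n} -> k) :
  detect (cubic H) = 6%:R * \sum_f \sum_g H f g * (a f * b g).
Proof.
rewrite /cubic raddf_sum mulr_sumr; apply: eq_bigr => f _ /=.
rewrite raddf_sum mulr_sumr; apply: eq_bigr => g _ /=.
by rewrite detectZ detect_xprod mulrCA.
Qed.

End Detection.

(** * Schur modules *)

Section Transport.
Variables (k : fieldType) (n : nat).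

Definition reindex_ten (B B' : finType) (th : B' -> B) (T : ten k B' n) : ten k B n :=
  [ffun f : {ffun B -> 'I_n} => T [ffun y => f (th y)]].

Fact reindex_ten_linear (B B' : finType) (th : B' -> B) : linear (reindex_ten th).
Proof. by move=> c T T'; apply/ffunP=> f; rewrite !ffunE. Qed.
HB.instance Definition _ (B B' : finType) (th : B' -> B) :=
  GRing.isLinear.Build k (ten k B' n) (ten k B n) _ (reindex_ten th) (reindex_ten_linear th).

Lemma reindex_tenK (B B' : finType) (th : B' -> B) (th' : B -> B') :
  cancel th' th -> cancel (reindex_ten th') (reindex_ten th).
Proof.
move=> K T; apply/ffunP=> f; rewrite !ffunE; congr (T _).
by apply/ffunP=> x; rewrite !ffunE K.
Qed.

End Transport.

Section Conjugation.
Variables (B B' : finType) (th : B' -> B) (th' : B -> B').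
Hypotheses (thK : cancel th th') (th'K : cancel th' th).

Lemma conj_inj (s : {perm B'}) : injective (fun x => th (s (th' x))).
Proof. by move=> x y /(can_inj thK) /perm_inj /(can_inj th'K). Qed.

Definition conj_perm (s : {perm B'}) : {perm B} := perm (@conj_inj s).

Lemma odd_conj_perm s : odd_perm (conj_perm s) = odd_perm s.
Proof.
apply: (@odd_perm_morph _ _ conj_perm th) => [|s1 s2|x y]; first exact: can_inj thK.
  by apply/perm.permP=> x; rewrite !permE /= !permE thK.
apply/perm.permP=> z; rewrite permE -{2}[z]th'K.
by case: tpermP => [->|->|n1 n2]; rewrite ?tpermL ?tpermR ?tpermD // (inj_eq (can_inj thK)) eq_sym;
  apply/eqP.
Qed.

End Conjugation.

Lemma conj_permK (B B' : finType) (th : B' -> B) (th' : B -> B')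
    (thK : cancel th th') (th'K : cancel th' th) :
  cancel (conj_perm thK th'K) (conj_perm th'K thK).
Proof. by move=> s; apply/perm.permP=> x; rewrite !permE !thK. Qed.

Lemma young_op_reindex (k : fieldType) n (B B' : finType) (th : B' -> B) (th' : B -> B')
    (thK : cancel th th') (th'K : cancel th' th) e (l : B -> nat) (T : ten k B' n) :
  young_op e l (reindex_ten th T) = reindex_ten th (young_op e (fun y => l (th y)) T).
Proof.
rewrite /young_op linear_sum (reindex (conj_perm thK th'K)) /=; last first.
  exists (conj_perm th'K thK) => s _; exact: conj_permK.
apply: eq_big => s.
  apply/youngP/youngP => h x; first by rewrite -[RHS]h permE thK.
  by rewrite permE h th'K.
rewrite odd_conj_perm linearZ => _ /=; congr (_ *: _); apply/ffunP=> f; rewrite !ffunE.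
by congr (T _); apply/ffunP=> x; rewrite !ffunE permE thK.
Qed.

Section Boxes.
Variables (la : seq nat) (B : finType) (row col : B -> nat).

Lemma card_box : #|{: box la}| = sumn la.
Proof.
rewrite card_tagged !sumnE big_map big_enum /= [RHS](big_nth 0%N) big_mkord.
by apply: eq_bigr => i _; rewrite card_ord.
Qed.

Hypotheses (inj : forall x y, row x = row y -> col x = col y -> x = y).
Hypotheses (row_lt : forall x, (row x < size la)%N).
Hypotheses (col_lt : forall x, (col x < nth 0%N la (row x))%N).
Hypothesis card_eq : #|B| = sumn la.

Lemma box_bij : exists (th : B -> box la) (th' : box la -> B),
  [/\ cancel th th', cancel th' th, forall x, row_of (th x) = row x &
      forall x, col_of (th x) = col x].
Proof.
pose th x : box la := @Tagged _ (Ordinal (row_lt x))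
  (fun i : 'I_(size la) => 'I_(nth 0%N la i)) (Ordinal (col_lt x)).
have th_inj : injective th.
  move=> x y e; apply: inj.
    by rewrite -[row x]/(row_of (th x)) e.
  by rewrite -[col x]/(col_of (th x)) e.
have [th' thK th'K] : bijective th by apply: inj_card_bij; rewrite // card_box card_eq.
by exists th, th'.
Qed.

End Boxes.

Section SchurModules.
Variables (k : fieldType) (la : seq nat) (n : nat).

Lemma row_altE (T : tens k la n) : row_alt k la n T = young_op true (@row_of la) T.
Proof.
rewrite lfunE /=; apply/ffunP=> f; rewrite !ffunE sum_ffunE.
by apply: eq_big => [s|s _]; rewrite ?inE // !ffunE.
Qed.

Lemma col_symE (T : tens k la n) : col_sym k la n T = young_op false (@col_of la) T.
Proof.
rewrite lfunE /=; apply/ffunP=> f; rewrite !ffunE sum_ffunE.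
by apply: eq_big => [s|s _]; rewrite ?inE // !ffunE [_ *: _]mul1r.
Qed.

Lemma mem_schur (T : tens k la n) :
  reflect (exists W : tens k la n,
      T = young_op false (@col_of la) (young_op true (@row_of la) W))
    (T \in schur k la n).
Proof.
apply: (iffP memv_imgP) => [[W _ ->]|[W ->]]; exists W; rewrite ?memvf //.
  by rewrite comp_lfunE row_altE col_symE.
by rewrite comp_lfunE row_altE col_symE.
Qed.

Lemma tens_act_delta (g : 'M[k]_n) (f : {ffun box la -> 'I_n}) :
  tens_act la g (delta k f) = \sum_(f' : {ffun box la -> 'I_n}) (\prod_x g (f' x) (f x)) *: delta k f'.
Proof.
have dE (f1 f2 : {ffun box la -> 'I_n}) : delta k f1 f2 = (f2 == f1)%:R by rewrite ffunE.
rewrite lfunE /=; apply/ffunP=> f'; rewrite ffunE sum_ffunE.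
rewrite (bigD1 f) //= dE eqxx mulr1 [X in _ + X]big1 ?addr0 => [|f'' /negPf nf]; last first.
  by rewrite dE nf mulr0.
rewrite (bigD1 f') //= ten_scaleE dE eqxx mulr1 [X in _ + X]big1 ?addr0 // => f'' /negPf nf.
by rewrite ten_scaleE dE eq_sym nf mulr0.
Qed.

End SchurModules.

Section Pigeonhole.
Variables (t u : nat).
Local Notation U := ('I_3 * 'I_t)%type.
Hypotheses (u_gt0 : (0 < u)%N) (le_2u_t : (2 * u <= t)%N).

(* The first row of the second shape is longer than the first row of the first
   shape, which bounds its number of columns. *)
Lemma column_row_collision (s : {perm U}) :
  exists x y, [/\ x != y, gcol u x = gcol u y & lrow u (s x) = lrow u (s y)].
Proof.
have lsh := lshape u_gt0 le_2u_t; have [ginj glt _] := gshape u_gt0 le_2u_t.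
have lt (c : 'I_(t + 2 * u)) : (0 < lht t u c)%N.
  by have := ltn_ord c; rewrite /lht; iflia.
pose z c := (s^-1)%g (s2val (boxP lsh (lt c))).
have zrow c : lrow u (s (z c)) = 0%N by rewrite /z permKV; case: (boxP lsh (lt c)).
have zcol c : lcol u (s (z c)) = c by rewrite /z permKV; case: (boxP lsh (lt c)).
have glt' (x : U) : (gcol u x < t + u)%N.
  by have := glt x; rewrite /ght; iflia.
pose w c : 'I_(t + u) := Ordinal (glt' (z c)).
have : ~~ injectiveb w.
  apply/negP=> /injectiveP /leq_card; rewrite !card_ord; lia.
case/injectivePn=> c [c' ncc' e]; exists (z c), (z c'); split.
- by apply: contra ncc' => /eqP e'; apply/eqP/val_inj; rewrite /= -!zcol e'.
- by have /(congr1 val) := e.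
- by rewrite !zrow.
Qed.

End Pigeonhole.

(** * The equivariant embedding into the cubic forms *)

Section Embedding.
Variables (k : fieldType) (t u m n : nat).
Local Notation U := ('I_3 * 'I_t)%type.
Hypotheses (char0 : [pchar k] =i pred0) (u_gt0 : (0 < u)%N) (le_2u_t : (2 * u <= t)%N).
Variables (ga la : seq nat).
Variables (thg : U -> box ga) (thg' : box ga -> U) (thl : U -> box la) (thl' : box la -> U).
Hypotheses (thgK : cancel thg thg') (thg'K : cancel thg' thg).
Hypotheses (thlK : cancel thl thl') (thl'K : cancel thl' thl).
Hypotheses (row_thg : forall x, row_of (thg x) = grow u x)
  (col_thg : forall x, col_of (thg x) = gcol u x).
Hypotheses (row_thl : forall x, row_of (thl x) = lrow u x)
  (col_thl : forall x, col_of (thl x) = lcol u x).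
Local Notation hom := (schur_hom k m n ga la).
Local Notation sch := (schur k la n).

Definition box_sym (mu : seq nat) l (W : ten k (box mu) l) : ten k (box mu) l :=
  young_op false (@col_of mu) (young_op true (@row_of mu) W).

Lemma reindex_gsym (W : ten k (box ga) m) :
  reindex_ten thg' (box_sym W) = gsym u (reindex_ten thg' W).
Proof.
rewrite /gsym !(young_op_reindex thg'K thgK) /box_sym; congr reindex_ten.
rewrite (@young_op_eq _ _ _ true (@row_of ga) (fun y => grow u (thg' y))) => [|x y]; last first.
  by rewrite -!row_thg !thg'K.
by apply: young_op_eq => x y; rewrite -!col_thg !thg'K.
Qed.

Lemma reindex_lcol (W : ten k (box la) n) :
  reindex_ten thl' (young_op false (@col_of la) W) = young_op false (lcol u) (reindex_ten thl' W).
Proof.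
rewrite (young_op_reindex thl'K thlK); congr reindex_ten.
by apply: young_op_eq => x y; rewrite -!col_thl !thl'K.
Qed.

Lemma reindex_lsym (W : ten k (box la) n) :
  reindex_ten thl' (box_sym W) = lsym u (reindex_ten thl' W).
Proof.
rewrite /box_sym reindex_lcol /lsym; congr young_op.
rewrite (young_op_reindex thl'K thlK); congr reindex_ten.
by apply: young_op_eq => x y; rewrite -!row_thl !thl'K.
Qed.

Lemma box_sym_schur mu l (W : ten k (box mu) l) : box_sym W \in schur k mu l.
Proof. by apply/mem_schur; exists W. Qed.

Definition to_box mu (th' : box mu -> U) l (f : {ffun U -> 'I_l}) : {ffun box mu -> 'I_l} :=
  [ffun y => f (th' y)].

Lemma to_box_bij mu (th : U -> box mu) th' l : cancel th th' -> cancel th' th ->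
  bijective (@to_box mu th' l).
Proof.
move=> K K'; exists (fun g : {ffun box mu -> 'I_l} => [ffun x : U => g (th x)] : {ffun U -> 'I_l}) => f; apply/ffunP=> x; rewrite !ffunE.
  by rewrite K.
by rewrite K'.
Qed.

Definition hom_val (h : hom) (W : ten k (box la) n) : ten k (box ga) m :=
  vsval (h (vsproj sch (box_sym W))).

Fact hom_val_linear h : linear (hom_val h).
Proof. by move=> c W W'; rewrite /hom_val /box_sym !linearP. Qed.
HB.instance Definition _ h :=
  GRing.isLinear.Build k (ten k (box la) n) (ten k (box ga) m) _ (hom_val h) (hom_val_linear h).

(** Without symmetrization along the columns of the second shape, this kernel keeps the antisymmetry
    along its rows, as [cubic_in_J] requires. *)
Definition row_kernel (h : hom) f g : k :=
  hom_val h (delta k (to_box thl' g)) (to_box thg' f).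

(* The additional symmetrization along the columns turns [detect_cubic] into an
   expression to which [symmetrizer_scalar] applies on the side of [V]. *)
Definition hom_kernel (h : hom) f g : k :=
  hom_val h (young_op false (@col_of la) (delta k (to_box thl' g))) (to_box thg' f).

Definition hom_cubic (h : hom) : polyS k t m n := cubic (hom_kernel h).

Fact hom_cubic_linear : linear hom_cubic.
Proof.
move=> c h h'; rewrite /hom_cubic /cubic scaler_sumr -big_split; apply: eq_bigr => f _ /=.
rewrite scaler_sumr -big_split; apply: eq_bigr => g _ /=.
rewrite scalerA -scalerDl; congr (_ *: _).
by rewrite /hom_kernel /hom_val add_lfunE scale_lfunE linearP !ffunE.
Qed.
HB.instance Definition _ :=
  GRing.isLinear.Build k hom (polyS k t m n) _ hom_cubic hom_cubic_linear.

Lemma schur_val (v : subvs_of (schur k ga m)) :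
  exists V, reindex_ten thg' (vsval v) = gsym u V.
Proof.
have /mem_schur[W ->] := subvsP v; exists (reindex_ten thg' W); exact: reindex_gsym.
Qed.

Lemma row_kernel_col h x y f g : gcol u x = gcol u y ->
  row_kernel h (comp_perm (tperm x y) f) g = row_kernel h f g.
Proof.
move=> e; rewrite /row_kernel /hom_val; set v := h _; have [V eV] := schur_val v.
have E f' : vsval v (to_box thg' f') = gsym u V f' by rewrite -eV ffunE.
rewrite !E; have := pl_young_op false (young_op true (grow u) V) (young_tperm e).
by move/(congr1 (fun z : ten k U m => z f)); rewrite scale1r ffunE.
Qed.

Lemma row_kernel_row h x y f g : x != y -> lrow u x = lrow u y ->
  row_kernel h f (comp_perm (tperm x y) g) = - row_kernel h f g.
Proof.
move=> nxy e; rewrite /row_kernel.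
have -> : to_box thl' (comp_perm (tperm x y) g) =
    comp_perm (tperm (thl x) (thl y))^-1%g (to_box thl' g).
  apply/ffunP=> z; rewrite tpermV !ffunE; congr (g _).
  rewrite -{2}[z]thl'K; move: (thl' z) => w; case: (tpermP x y w) => [->|->|nx ny].
  - by rewrite tpermL thlK.
  - by rewrite tpermR thlK.
  by rewrite tpermD ?thlK // (inj_eq (can_inj thlK)) eq_sym; apply/eqP.
rewrite -pl_delta /hom_val /box_sym young_op_pl; last by apply: young_tperm; rewrite !row_thl.
rewrite odd_tperm (inj_eq (can_inj thlK)) nxy expr1 scaleN1r !linearN /=.
by rewrite ffunE.
Qed.

Lemma hom_cubicE h :
  hom_cubic h = \sum_(s in young (@col_of la))
    cubic (fun f g => row_kernel h f (comp_perm (conj_perm thl'K thlK s^-1%g) g)).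
Proof.
rewrite /hom_cubic /cubic [RHS]exchange_big; apply: eq_bigr => f _ /=.
rewrite [RHS]exchange_big; apply: eq_bigr => g _ /=.
rewrite -scaler_suml; congr (_ *: _).
rewrite /hom_kernel {1}/young_op linear_sum sum_ffunE; apply: eq_bigr => s _.
rewrite /row_kernel expr0 scale1r pl_delta; congr (hom_val h (delta k _) _).
by apply/ffunP=> z; rewrite !ffunE [conj_perm _ _ _ _]permE thl'K.
Qed.

Lemma hom_cubic_in_J h : in_J (hom_cubic h).
Proof.
rewrite hom_cubicE /in_J /minor_map raddf_sum big1 // => s _; apply: (cubic_in_J char0).
move=> p; set c := conj_perm _ _ _.
(* The kernel reads [g] through the relabelling [c], which shifts the matching [p]. *)
have [x [y [nxy eg el]]] := column_row_collision u_gt0 le_2u_t (p * c^-1)%g.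
exists x, y; split=> f g; first by rewrite row_kernel_col.
have -> : comp_perm c (comp_perm (tperm (p x) (p y)) g) =
   comp_perm (tperm ((p * c^-1)%g x) ((p * c^-1)%g y)) (comp_perm c g).
  rewrite !comp_permM !permM; congr comp_perm.
  by rewrite -{1}[p x](permKV c) -{1}[p y](permKV c) -(tpermJ _ _ c) conjgE !mulgA mulgV mul1g.
by rewrite row_kernel_row // (inj_eq perm_inj).
Qed.

Lemma schur_act_proj (b : 'M[k]_n) (W : tens k la n) : W \in sch ->
  schur_act la b (vsproj sch W) = vsproj sch (tens_act la b W).
Proof.
move=> WS; apply: val_inj; rewrite /= vsval_schur_act !vsprojK //.
exact: schur_stable.
Qed.

Lemma tens_act_box_sym mu l (b : 'M[k]_l) (W : tens k mu l) :
  tens_act mu b (box_sym W) = box_sym (tens_act mu b W).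
Proof. by rewrite /box_sym -!col_symE -!row_altE tens_act_col_sym tens_act_row_alt. Qed.

Lemma hom_val_act a (b : 'M[k]_n) h W :
  hom_val (schur_hom_act a b h) W = tens_act ga a (hom_val h (tens_act la (invmx b) W)).
Proof.
rewrite /hom_val /schur_hom_act comp_lfunE comp_lfunE vsval_schur_act.
by rewrite schur_act_proj ?box_sym_schur // tens_act_box_sym.
Qed.

Lemma sum_to_box (V : nmodType) mu (th : U -> box mu) th' l (F : {ffun box mu -> 'I_l} -> V) :
  cancel th th' -> cancel th' th -> \sum_f F f = \sum_f F (to_box th' f).
Proof. by move=> K K'; apply: reindex; apply: onW_bij; apply: to_box_bij K K'. Qed.

Lemma prod_to_box mu (th : U -> box mu) th' l (b : 'M[k]_l) f f' :
  cancel th th' -> cancel th' th ->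
  \prod_y b (to_box th' f y) (to_box th' f' y) = \prod_x b (f x) (f' x).
Proof.
move=> K K'; rewrite (reindex th); last by apply/onW_bij; exists th'.
by apply: eq_bigr => x _; rewrite !ffunE K.
Qed.

Lemma hom_kernel_act a b h f g :
  hom_kernel (schur_hom_act a b h) f g =
  \sum_(f' : {ffun U -> 'I_m}) \sum_(g' : {ffun U -> 'I_n})
    (\prod_x a (f x) (f' x)) * (\prod_x invmx b (g' x) (g x)) * hom_kernel h f' g'.
Proof.
rewrite /hom_kernel hom_val_act -col_symE tens_act_col_sym tens_act_delta.
rewrite (sum_to_box _ thlK thl'K) linear_sum linear_sum linear_sum sum_ffunE exchange_big.
apply: eq_bigr => g' _ /=; rewrite !linearZ /= col_symE ten_scaleE (prod_to_box _ _ _ thlK thl'K).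
have taE (X : tens k ga m) f' : tens_act ga a X f' =
    \sum_(f1 : {ffun box ga -> 'I_m}) (\prod_x a (f' x) (f1 x)) * X f1.
  by rewrite lfunE ffunE.
rewrite taE (sum_to_box _ thgK thg'K) mulr_sumr.
by apply: eq_bigr => f' _; rewrite (prod_to_box _ _ _ thgK thg'K) mulrCA mulrA.
Qed.

Lemma hom_cubic_act a b h : hom_cubic (schur_hom_act a b h) = actS a b (hom_cubic h).
Proof.
rewrite /hom_cubic (actS_cubic char0); apply: eq_bigr => f _; apply: eq_bigr => g _.
by rewrite hom_kernel_act.
Qed.

Lemma reindex_to_box (W : ten k (box ga) m) f : reindex_ten thg' W f = W (to_box thg' f).
Proof. by rewrite ffunE. Qed.

Lemma hom_cubic_mJ h : in_mJ (hom_cubic h) -> h = 0.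
Proof.
move=> hmJ; have k2 := two_neq0 char0.
have [z z_neq0 zP] := symmetrizer_scalar (gshape u_gt0 le_2u_t) (gsemistd u_gt0 le_2u_t).
have [z' z'_neq0 zP'] := symmetrizer_scalar (lshape u_gt0 le_2u_t) (lsemistd u_gt0 le_2u_t).
have int_neq0 (y : int) : y != 0 -> y%:~R != 0 :> k.
  case: y => y; first by rewrite ((pcharf0P k).1 char0).
  by move=> _; rewrite NegzE mulrNz oppr_eq0 -pmulrn ((pcharf0P k).1 char0).
suff vanish W : hom_val h W = 0.
  apply/lfunP=> v; apply: val_inj; have /mem_schur[W eW] := subvsP v.
  have := vanish W; rewrite /hom_val -[box_sym W]eW vsvalK => hv.
  by transitivity (0 : tens k ga m); rewrite ?zero_lfunE.
have [V eV] : exists V, reindex_ten thg' (hom_val h W) = gsym u V by apply: schur_val.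
apply: (can_inj (reindex_tenK (k := k) (n := m) thg'K)); rewrite linear0.
apply/ffunP=> f0; rewrite [RHS]ffunE.
(* With this choice [symmetrizer_scalar] applies once on each side, and the functional reads off
   [6 * z * z'] times the coefficient of [hom_val h W] at [f0]. *)
pose T := young_op false (gcol u) (delta k f0); pose T' := reindex_ten thl' W.
have := detect_cubic char0 u_gt0 le_2u_t T T' (hom_kernel h).
rewrite -/(hom_cubic h) (detect_mJ char0 u_gt0 le_2u_t T T' hmJ).
have sum_g f : \sum_g hom_kernel h f g * balt (lsym u T') g =
    z'%:~R * hom_val h W (to_box thg' f).
  have b_box : \sum_g balt (lsym u T') g *: delta k (to_box thl' g) =
      reindex_ten thl (balt (lsym u T')).
    rewrite [RHS]ten_delta (sum_to_box _ thlK thl'K); apply: eq_bigr => g _.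
    congr (_ *: _); rewrite [RHS]ffunE; congr (balt _ _).
    by apply/ffunP=> x; rewrite !ffunE thlK.
  have sym_eq : box_sym (young_op false (@col_of la) (reindex_ten thl (balt (lsym u T')))) =
      z'%:~R *: box_sym W.
    apply: (can_inj (reindex_tenK (k := k) (n := n) thl'K)); rewrite linearZ /= !reindex_lsym reindex_lcol.
    by rewrite (reindex_tenK thlK) /gsym /lsym zP'.
  have := congr1 (fun X => vsval (h (vsproj sch X)) (to_box thg' f)) sym_eq.
  rewrite !linearZ /= ten_scaleE => <-; rewrite -/(hom_val _ _) -b_box.
  rewrite [young_op _ _ (\sum_g _)]linear_sum.
  rewrite [hom_val h (\sum_g _)]linear_sum sum_ffunE; apply: eq_bigr => g _.
  by rewrite !linearZ /= ten_scaleE mulrC.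
rewrite (_ : \sum_f \sum_g _ = z'%:~R * (z%:~R * gsym u V f0)).
  rewrite -eV => /esym/eqP; rewrite !mulf_eq0 ((pcharf0P k).1 char0) /=.
  by rewrite (negPf (int_neq0 _ z_neq0)) (negPf (int_neq0 _ z'_neq0)) => /eqP.
transitivity (\sum_f balt (gsym u T) f * (z'%:~R * gsym u V f)).
  apply: eq_bigr => f _; rewrite -eV reindex_to_box -sum_g mulr_sumr; apply: eq_bigr => g _.
  by rewrite mulrCA.
transitivity (z'%:~R * dot (balt (gsym u T)) (gsym u V)).
  by rewrite mulr_sumr; apply: eq_bigr => f _; rewrite mulrCA.
congr (_ * _); rewrite /T /balt /gsym !dot_young_op zP //.
by rewrite dotC dotZl dot_delta.
Qed.

End Embedding.

(** * Nonvanishing of the Schur modules and conclusion *)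

Lemma schur_neq0 (k : fieldType) (mu : seq nat) l :
  [pchar k] =i pred0 -> (forall y : box mu, (col_of y < l)%N) ->
  exists W : tens k mu l, box_sym W != 0.
Proof.
(* Each box carries its column number. Column permutations fix [f0] and no other row permutation
   than 1 does, so the coefficient at [f0] is the order of the column group. *)
move=> char0 lt; pose f0 : {ffun box mu -> 'I_l} := [ffun y => Ordinal (lt y)].
have box_inj (y y' : box mu) : row_of y = row_of y' -> col_of y = col_of y' -> y = y'.
  case: y y' => [i c] [i' c']; rewrite /row_of /col_of /= => /val_inj e.
  by case: i' / e c' => c' /val_inj ->.
exists (delta k f0); apply/eqP=> /ffunP/(_ f0)/eqP; rewrite [X in _ == X]ffunE; apply/negP.
have f0_col (p : {perm box mu}) : p \in young (@col_of mu) -> comp_perm p f0 = f0.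
  by move/youngP=> pY; apply/ffunP=> y; apply/val_inj; rewrite !ffunE /= pY.
rewrite /box_sym {1}/young_op sum_ffunE.
rewrite (eq_bigr (fun=> 1)) => [|p pY].
  by rewrite sumr_const ((pcharf0P k).1 char0) -lt0n; apply/card_gt0P; exists 1%g; apply: young1.
rewrite expr0 scale1r ffunE f0_col // /young_op sum_ffunE.
rewrite (bigD1 1%g) ?young1 //= [X in _ + X]big1 ?addr0 => [|q /andP[/youngP qY nq]].
  by rewrite odd_perm1 expr0 scale1r pl1 ffunE eqxx.
rewrite ten_scaleE !ffunE; case: eqP => [/ffunP e|_]; last by rewrite mulr0.
case/eqP: nq; apply/perm.permP=> y; rewrite perm1; apply: box_inj => //.
by have /(congr1 val) := e y; rewrite !ffunE.
Qed.

(** A map of rank one: a coordinate not vanishing on the source times a nonzero vector of the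
    target. *)
Lemma schur_hom_neq0 (k : fieldType) m n (ga la : seq nat) :
  [pchar k] =i pred0 -> (forall y : box ga, (col_of y < m)%N) ->
  (forall y : box la, (col_of y < n)%N) -> exists h : schur_hom k m n ga la, h != 0.
Proof.
move=> char0 /(schur_neq0 char0)[V V0] /(schur_neq0 char0)[W W0].
have [f0 Wf0] : exists f0, box_sym W f0 != 0.
  apply/existsP; apply: contraNT W0 => /existsPn h; apply/eqP/ffunP=> f.
  by rewrite [RHS]ffunE; apply/eqP; have := h f; rewrite negbK.
pose v := vsproj (schur k ga m) (box_sym V).
pose ell (w : subvs_of (schur k la n)) : subvs_of (schur k ga m) :=
  (vsval w f0 : k) *: v.
have ell_lin : linear ell.
  by move=> c w w'; rewrite /ell linearP !ffunE scalerDl scalerA.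
pose L : {linear _ -> _} := HB.pack ell (GRing.isLinear.Build _ _ _ _ ell ell_lin).
exists (linfun L); apply/eqP=> /lfunP/(_ (vsproj _ (box_sym W)))/(congr1 vsval)/eqP.
rewrite lfunE zero_lfunE /= /ell /v !vsprojK ?box_sym_schur // scaler_eq0.
by rewrite (negPf Wf0) (negPf V0).
Qed.

(** The first parts of the shapes fit in [m] and [n], so both Schur modules are nonzero. Injectivity
    comes with minimality, as 0 satisfies [in_mJ]. *)
Lemma cubic_minimal_irreducible (k : fieldType) (char0 : [pchar k] =i pred0) (t u m n : nat) :
  (0 < u)%N -> (2 * u <= t)%N -> (t + u <= m)%N -> (t + 2 * u <= n)%N ->
  minimal_irreducible k t m n 3 [:: t + u; t + u; t - 2 * u]%N [:: t + 2 * u; t - u; t - u]%N.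
Proof.
move=> u_gt0 le_2u le_m le_n; set ga := [:: t + u; _; _]%N; set la := [:: t + 2 * u; _; _]%N.
have [ginj glt _] := gshape u_gt0 le_2u; have [linj llt _] := lshape u_gt0 le_2u.
have [|||thg [thg' [thgK thg'K row_thg col_thg]]] := @box_bij ga _ (grow u) (@gcol t u) ginj.
- by move=> [[b hb] [j hj]]; rewrite /grow /=; iflia.
- move=> [[b hb] [j hj]]; rewrite /grow /gcol /=.
  by case: b hb => [|[|[|//]]] _ /=; iflia.
- by rewrite card_prod !card_ord /=; lia.
have [|||thl [thl' [thlK thl'K row_thl col_thl]]] := @box_bij la _ (lrow u) (@lcol t u) linj.
- by move=> [[b hb] [j hj]]; rewrite /lrow /=; iflia.
- move=> [[b hb] [j hj]]; rewrite /lrow /lcol /=.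
  by case: b hb => [|[|[|//]]] _ /=; iflia.
- by rewrite card_prod !card_ord /=; lia.
split.
  apply: (schur_hom_neq0 char0) => -[[i hi] [c hc]]; rewrite /col_of /=.
    by move: hc => /=; case: i hi => [|[|[|//]]] /= _; lia.
  by move: hc => /=; case: i hi => [|[|[|//]]] /= _; lia.
have key := hom_cubic_mJ char0 u_gt0 le_2u thgK thg'K thlK thl'K row_thg col_thg row_thl col_thl
  (k := k) (m := m) (n := n).
exists (hom_cubic thg' thl' (k := k) (m := m) (n := n) (t := t)).
have inJ := hom_cubic_in_J char0 u_gt0 le_2u thgK thg'K thlK thl'K row_thg col_thg row_thl (m := m) (n := n).
have mJ0 : in_mJ (0 : polyS k t m n) by exists [::]; split => //; rewrite big_nil.
split => [|a b h _ _|h|h h0].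
- by apply: raddf_inj => h e; apply: key; rewrite e.
- exact: (hom_cubic_act char0 thgK thg'K thlK thl'K).
- by split; [apply: cubic_homog | apply: inJ].
by split; [apply: inJ | move=> /key h_eq0; rewrite h_eq0 eqxx in h0].
Qed.

Theorem theorem3p1p6 (k : fieldType) (k_char0 : [pchar k] =i pred0)
    (t m n : nat) (t_gt1 : (1 < t)%N) (lt_t_m : (t < m)%N)
    (le_m_n : (m <= n)%N) (n_gt : (n > t + 1)%N)
    (i : nat) (i_range : (1 <= i <= t %/ 2)%N) :
  (~~ odd t ->
   Num.max 0 (Num.max (3 * t%:Q / 2 - m%:Q + 1) (t%:Q - n%:Q / 2 + 1))
     <= i%:Q <= t%:Q / 2 ->
   minimal_irreducible k t m n 3 (gamma t i) (lambda t i)) /\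
  (odd t ->
   Num.max 0 (Num.max ((3 * t%:Q - 1) / 2 - m%:Q + 1) (t%:Q - (n%:Q - 1) / 2))
     <= i%:Q <= (t%:Q - 1) / 2 ->
   minimal_irreducible k t m n 3 (gamma t i) (lambda t i)).
Proof.
case/andP: i_range => i_gt0 i_le; pose u := (t %/ 2 - i + 1)%N.
have u_gt0 : (0 < u)%N by rewrite /u; lia.
have le_2u : (2 * u <= t)%N by rewrite /u; lia.
have toQ (x y : int) : (x%:~R <= y%:~R :> rat) = (x <= y) by rewrite ler_int.
(* In both parities the bounds on [i] amount to [t + u <= m] and [t + 2 * u <= n]; doubling clears
   the halves and allows passing to integers. *)
split=> t_odd /andP[]; rewrite !ge_max => /and3P[_ h1 h2] _.
  have le_m : (t + u <= m)%N.
    have : (3 * t%:Z - 2 * m%:Z + 2)%:~R <= (2 * i%:Z)%:~R :> rat by rewrite !(rmorphD, rmorphB, rmorphM) /=; lra.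
    by rewrite toQ /u; lia.
  have le_n : (t + 2 * u <= n)%N.
    have : (2 * t%:Z - n%:Z + 2)%:~R <= (2 * i%:Z)%:~R :> rat by rewrite !(rmorphD, rmorphB, rmorphM) /=; lra.
    by rewrite toQ /u; lia.
  have := cubic_minimal_irreducible k_char0 u_gt0 le_2u le_m le_n.
  rewrite /gamma /lambda (negPf t_odd).
  rewrite (_ : (3 * t) %/ 2 - i + 1 = t + u)%N; last by rewrite /u; lia.
  rewrite (_ : 2 * (i - 1) = t - 2 * u)%N; last by rewrite /u; lia.
  rewrite (_ : 2 * (t - i + 1) = t + 2 * u)%N; last by rewrite /u; lia.
  by rewrite (_ : t %/ 2 + i - 1 = t - u)%N; last by rewrite /u; lia.
have le_m : (t + u <= m)%N.
  have : (3 * t%:Z - 1 - 2 * m%:Z + 2)%:~R <= (2 * i%:Z)%:~R :> rat by rewrite !(rmorphD, rmorphB, rmorphM) /=; lra.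
  by rewrite toQ /u; lia.
have le_n : (t + 2 * u <= n)%N.
  have : (2 * t%:Z - n%:Z + 1)%:~R <= (2 * i%:Z)%:~R :> rat by rewrite !(rmorphD, rmorphB, rmorphM) /=; lra.
  by rewrite toQ /u; lia.
have := cubic_minimal_irreducible k_char0 u_gt0 le_2u le_m le_n.
rewrite /gamma /lambda t_odd.
rewrite (_ : (3 * t - 1) %/ 2 - i + 1 = t + u)%N; last by rewrite /u; lia.
rewrite (_ : 2 * (i - 1) + 1 = t - 2 * u)%N; last by rewrite /u; lia.
rewrite (_ : 2 * (t - i + 1) - 1 = t + 2 * u)%N; last by rewrite /u; lia.
by rewrite (_ : (t + 1) %/ 2 + i - 1 = t - u)%N; last by rewrite /u; lia.
Qed.
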